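(* Let each $f_i:\mathbb{R}^m\to\mathbb{R}$ ($i\in[n]$) be $r+1$ times continuously differentiable for some $r\ge 1$ with $\nabla f_i$ being $L_i$-Lipschitz continuous, let $F=\sum_i f_i$ be coercive, and let the digraph $\mathcal G$ be strongly connected (connected, if undirected). Let $\{(\mathbf{x}^\nu,\mathbf{y}^\nu)\}$ be generated by the DOGT iteration with $\mathbf R,\mathbf C$ satisfying the weight-matrix assumption in the context, and with the step-size $\alpha$ chosen according to $$0<\alpha\le\frac{(1-\rho_R^2)^2(1-\rho_C^2)^2\,r_{\min}^2c_{\min}^2}{1152\,L_c^2(\mathsf L+16n)}$$ (with the auxiliary parameters $\epsilon_x,\epsilon_y,\epsilon_1,\varkappa$ fixed as in (a) of the context), or, alternatively, according to the base step-size conditions (b) of the context. Let $\bar{\mathbf x}^\nu=(\mathbf r^\top\otimes\mathbf I_m)\mathbf{x}^\nu$, $\bar{\mathbf y}^\nu=(\mathbf 1^\top\otimes\mathbf I_m)\mathbf{y}^\nu$, and let $d(\cdot,\cdot)$ be the function defined in the context. For $\epsilon>0$ let $T_\epsilon=\min\{\nu\in\mathbb{N}_+: d(\mathbf{x}^\nu,\mathbf{y}^\nu)\le\epsilon\}$. Then: (i) [consensus] $\lim_{\nu\to\infty}\|\mathbf{x}^\nu-\mathbf 1\otimes\bar{\mathbf x}^\nu\|=0$ and $\lim_{\nu\to\infty}\bar{\mathbf y}^\nu=\mathbf 0$; (ii) [stationarity] if $\mathbf{x}^\infty$ is a limit point of $\{\mathbf{x}^\nu\}$, then $\mathbf{x}^\infty=\mathbf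 1\otimes\boldsymbol\theta^\infty$ for some $\boldsymbol\theta^\infty\in\mathrm{crit}\,F$; (iii) [sublinear rate] $T_\epsilon=o(1/\epsilon^2)$ as $\epsilon\to0$.
   Context: Functions: $F=\sum_{i=1}^nf_i$, $\mathrm{crit}\,F=\{\boldsymbol\theta:\nabla F(\boldsymbol\theta)=\mathbf 0\}$; for $\mathbf{x}=[\mathbf{x}_1^\top,\ldots,\mathbf{x}_n^\top]^\top\in\mathbb{R}^{mn}$, $F_c(\mathbf{x})=\sum_if_i(\mathbf{x}_i)$. $L_c=\max_iL_i$ is the Lipschitz constant of $\nabla F_c$, and $\mathsf L$ denotes a Lipschitz constant of $\nabla F$. Coercive: tends to $+\infty$ as the argument tends to infinity in norm. $\mathbb{N}_+$ is the set of nonnegative integers; $\mathbf 1$ is the all-ones vector in $\mathbb{R}^n$. Network and weights: $\mathcal G=([n],\mathcal E)$ is a (possibly directed) graph. For a nonnegative $\mathbf A\in\mathbb{R}^{n\times n}$, $\mathcal G_A$ is the digraph on $[n]$ with edge $(j,i)$ iff $A_{ij}>0$, and $\mathcal R_A$ is the set of roots of directed spanning trees of $\mathcal G_A$. Weight-matrix assumption: $\mathbf R$ is nonnegative row-stochastic with $R_{ii}>0$; $\mathbf C$ is nonnegative column-stochastic with $C_{ii}>0$; both are compliant to $\mathcal G$ (for $i\ne j$ the $(i,j)$ entry is zero if $(j,i)\notin\mathcal E$); $\mathcal G_R$ and $\mathcal G_{C^\top}$ each contain a spanning tree, and $\mathcal R_R\cap\mathcal R_{C^\top}\neq\emptyset$.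 Let $\mathbf r,\mathbf c$ be the stochastic vectors with $\mathbf r^\top\mathbf R=\mathbf r^\top$, $\mathbf C\mathbf c=\mathbf c$, with minimal/maximal entries $r_{\min},r_{\max},c_{\min},c_{\max}$ (the constants below presuppose $r_{\min},c_{\min}>0$); $\zeta=\mathbf r^\top\mathbf c>0$. Let $\|\mathbf{x}\|_R=\|(\mathrm{diag}(\sqrt{\mathbf r})\otimes\mathbf I_m)\mathbf{x}\|_2$, $\|\mathbf{y}\|_C=\|(\mathrm{diag}(\sqrt{\mathbf c})^{-1}\otimes\mathbf I_m)\mathbf{y}\|_2$, $\rho_R=\|\mathrm{diag}(\sqrt{\mathbf r})(\mathbf R-\mathbf 1\mathbf r^\top)\mathrm{diag}(\sqrt{\mathbf r})^{-1}\|_2<1$, $\rho_C=\|\mathrm{diag}(\sqrt{\mathbf c})^{-1}(\mathbf C-\mathbf c\mathbf 1^\top)\mathrm{diag}(\sqrt{\mathbf c})\|_2<1$, $\mathbf J_R=(\mathbf 1\mathbf r^\top)\otimes\mathbf I_m$, $\mathbf J_C=(\mathbf c\mathbf 1^\top)\otimes\mathbf I_m$. DOGT: $\mathbf{x}^{\nu+1}=\mathbf W_R\mathbf{x}^\nu-\alpha\mathbf{y}^\nu$, $\mathbf{y}^{\nu+1}=\mathbf W_C\mathbf{y}^\nu+\nabla F_c(\mathbf{x}^{\nu+1})-\nabla F_c(\mathbf{x}^\nu)$, with $\mathbf W_R=\mathbf R\otimes\mathbf I_m$, $\mathbf W_C=\mathbf C\otimes\mathbf I_m$, $\mathbf{x}^0\in\mathbb{R}^{mn}$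 and $\mathbf{y}^0\in\nabla F_c(\mathbf{x}^0)+\mathrm{span}(\mathbf W_C-\mathbf I)$ (span = column space). Constants: $K_{2,R}=1/\sqrt{r_{\min}}$, $K_{2,C}=\sqrt{c_{\max}}$, $K_{C,2}=1/\sqrt{c_{\min}}$, $K_{R,C}=\sqrt{r_{\max}c_{\max}}$; $K_2=2K_{R,C}^2(1+\frac1{\epsilon_x})$, $K_3=2n(1+\frac1{\epsilon_x})$, $K_4=3K_{C,2}^2K_{2,C}^2L_c^2$, $K_5=3K_{C,2}^2L_c^2$, $K_6=3K_{C,2}^2K_{2,R}^2L_c^2$. (a) Parameters accompanying the explicit step-size bound in the claim: $\epsilon_x=\frac{1-\rho_R^2}{4\rho_R^2}$, $\epsilon_y=\frac{1-\rho_C^2}{2\rho_C^2}$, $\epsilon_1=\frac{\zeta}{1+\zeta}$, $\varkappa=\frac{c_{\min}r_{\min}}{24L_c^2}(1-\rho_R^2)(1-\rho_C^2)$. (b) Base step-size conditions: $0<\epsilon_x<\frac{1-\rho_R^2}{2\rho_R^2}$, $0<\epsilon_y<\frac{1-\rho_C^2}{\rho_C^2}$, $0<\epsilon_1<\frac{2\zeta}{1+\zeta}$, $0<\varkappa\le\frac{\rho_R^2\epsilon_x}{K_6(1+1/\epsilon_y)}$, and $\alpha>0$ satisfies $$\alpha<\frac{2\,(1-\rho_R^2(1+2\epsilon_x))}{nL_c^2K_{2,R}^2(1+\zeta/\epsilon_1)},\quad \alpha<\frac{1-\rho_C^2(1+\epsilon_y)}{\frac1{2\varkappa}K_{2,C}^2(1+\frac1{\epsilon_1}+2\mathsf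 L)+\frac{K_2}{\varkappa}+K_4(1+\frac1{\epsilon_y})},\quad \alpha<\frac{\zeta-\frac{\epsilon_1}2(\zeta+1)}{\mathsf L\zeta^2+K_3+K_5\varkappa}.$$ Function $d$ (with the parameters $\epsilon_x,\epsilon_y,\epsilon_1,\varkappa$ of the chosen option): $$d(\mathbf{x},\mathbf{y})=\sqrt{(1-\tilde\rho_R)\|(\mathbf I-\mathbf J_R)\mathbf{x}\|_R^2+\varkappa(1-\tilde\rho_C)\|(\mathbf I-\mathbf J_C)\mathbf{y}\|_C^2+\Gamma\Big\|\sum_{i=1}^n\nabla f_i(\mathbf{x}_i)\Big\|^2},$$ where $\tilde\rho_R=\rho_R^2(1+\epsilon_x)+\frac{\alpha nL_c^2K_{2,R}^2}{2}(1+\frac\zeta{\epsilon_1})+\varkappa K_6(1+\frac1{\epsilon_y})$, $\tilde\rho_C=\rho_C^2(1+\epsilon_y)+\frac{\alpha K_{2,C}^2}{2\varkappa}(1+\frac1{\epsilon_1})+\alpha^2\big(\frac{\mathsf LK_{2,C}^2+K_2}{\varkappa}+K_4(1+\frac1{\epsilon_y})\big)$, $\Gamma=(\zeta-\frac{\epsilon_1\zeta}2-\frac{\epsilon_1}2)\alpha-(\mathsf L\zeta^2+K_3+K_5\varkappa)\alpha^2$. The paper chooses the parameters and the step-size in order to ensure $\tilde\rho_R<1$, $\tilde\rho_C<1$ and $\Gamma>0$.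
   Formalization: For the explicit step-size option (a), Γ>0 is also required; it follows from the bound when L_c≥1, but for very small L_c the bound alone permits divergence. If ρ_R=0 or ρ_C=0, the corresponding ϵ_x or ϵ_y and its inverse are read as 0. *)

(* Defs.v *)
From HB Require Import structures.
From mathcomp Require Import all_boot all_order all_algebra.
From mathcomp Require Import all_classical all_reals all_analysis.
Set Implicit Arguments.
Unset Strict Implicit.
Unset Printing Implicit Defensive.
Import Order.TTheory GRing.Theory Num.Theory.
Import numFieldNormedType.Exports.
Local Open Scope classical_set_scope.
Local Open Scope ring_scope.

(* Conventions.  A stacked vector x = [x_1; ...; x_n] of R^(mn) is represented
   by the n x m matrix whose i-th row is x_i^T, so that (A (x) I_m) x becomes
   A *m x, 1 (x) theta becomes ones *m theta, and the Euclidean norm of x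
   becomes the Frobenius norm.  The norm `|_| of the library on matrices is the
   sup norm; it induces the same topology, but every quantitative statement
   below uses enorm. *)

Definition enorm (K : realType) p q (A : 'M[K]_(p, q)) : K :=
  Num.sqrt (\sum_i \sum_j A i j ^+ 2).

Definition opnorm2 (K : realType) n (A : 'M[K]_n) : K :=
  sup [set enorm (A *m v) | v in [set v : 'cV[K]_n | enorm v <= 1]].

Definition grad (K : realType) p q (g : 'M[K]_(p, q) -> K) (x : 'M[K]_(p, q)) :
    'M[K]_(p, q) :=
  \matrix_(i, j) 'D_(delta_mx i j) g x.

(* Class C^k, in the Frechet sense: g is C^(k+1) iff it is differentiable and
   x |-> 'd g x is C^k, i.e. x |-> 'd g x v = 'D_v g x is C^k for every v. *)
Fixpoint class_C (K : realType) (V : normedModType K) (k : nat) (g : V -> K) :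
    Prop :=
  match k with
  | 0 => continuous g
  | k'.+1 => (forall x, differentiable g x) /\
             (forall v, class_C k' (fun x => 'D_v g x))
  end.

Definition elipschitz (K : realType) p q p' q' (L : K)
    (g : 'M[K]_(p, q) -> 'M[K]_(p', q')) : Prop :=
  forall x y, enorm (g x - g y) <= L * enorm (x - y).

Definition coercive (K : realType) p q (g : 'M[K]_(p, q) -> K) : Prop :=
  forall M : K, exists B : K, forall x, B < enorm x -> M < g x.

Definition crit (K : realType) p q (g : 'M[K]_(p, q) -> K) :
    set 'M[K]_(p, q) := [set x | grad g x = 0].

Definition Fsum (K : realType) n m (f : 'I_n -> 'rV[K]_m -> K)
    (theta : 'rV[K]_m) : K := \sum_i f i theta.

Definition Fc (K : realType) n m (f : 'I_n -> 'rV[K]_m -> K)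
    (x : 'M[K]_(n, m)) : K := \sum_i f i (row i x).

Definition Lmax (K : realType) n (L : 'I_n -> K) : K :=
  \big[Num.max/0]_i L i.

Definition strongly_connected (V : finType) (E : rel V) : Prop :=
  forall u v, connect E u v.

(* T is a directed spanning tree with root k of the digraph E: it uses edges of
   E only, and every vertex is the end of exactly one directed T-walk from k. *)
Definition spanning_tree (V : finType) (E T : rel V) (k : V) : Prop :=
  subrel T E /\ forall v, exists! p : seq V, path T k p /\ last k p = v.

Definition tree_roots (V : finType) (E : rel V) : set V :=
  [set k | exists T : rel V, spanning_tree E T k].

(* The digraph G_A: (j, i) is an edge iff A i j > 0. *)
Definition digraph_of (K : realType) n (A : 'M[K]_n) : rel 'I_n :=
  [rel j i | 0 < A i j].

Definition compliant (K : realType) n (E : rel 'I_n) (A : 'M[K]_n) : Prop :=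
  forall i j, i != j -> ~~ E j i -> A i j = 0.

Definition ones (K : realType) n : 'cV[K]_n := const_mx 1.

Definition row_stochastic (K : realType) n (A : 'M[K]_n) : Prop :=
  (forall i j, 0 <= A i j) /\ A *m ones K n = ones K n.

Definition col_stochastic (K : realType) n (A : 'M[K]_n) : Prop :=
  (forall i j, 0 <= A i j) /\ (ones K n)^T *m A = (ones K n)^T.

Definition stochastic_vec (K : realType) n (v : 'cV[K]_n) : Prop :=
  (forall i, 0 <= v i 0) /\ \sum_i v i 0 = 1.

Definition weight_assumption (K : realType) n (E : rel 'I_n) (R C : 'M[K]_n) :
    Prop :=
  [/\ row_stochastic R /\ (forall i, 0 < R i i),
      col_stochastic C /\ (forall i, 0 < C i i),
      compliant E R /\ compliant E C,
      tree_roots (digraph_of R) !=set0 /\ tree_roots (digraph_of C^T) !=set0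
    & tree_roots (digraph_of R) `&` tree_roots (digraph_of C^T) !=set0].

(* Extremal entries; the neutral elements 1 and 0 are harmless because these are
   only used on stochastic vectors, whose entries lie in [0, 1]. *)
Definition vmin (K : realType) n (v : 'cV[K]_n) : K := \big[Num.min/1]_i v i 0.
Definition vmax (K : realType) n (v : 'cV[K]_n) : K := \big[Num.max/0]_i v i 0.

Definition zeta (K : realType) n (r c : 'cV[K]_n) : K := (r^T *m c) 0 0.

Definition diag_sqrt (K : realType) n (v : 'cV[K]_n) : 'M[K]_n :=
  diag_mx (\row_i Num.sqrt (v i 0)).

Definition normR (K : realType) n m (r : 'cV[K]_n) (x : 'M[K]_(n, m)) : K :=
  enorm (diag_sqrt r *m x).

Definition normC (K : realType) n m (c : 'cV[K]_n) (y : 'M[K]_(n, m)) : K :=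
  enorm (invmx (diag_sqrt c) *m y).

Definition JR (K : realType) n (r : 'cV[K]_n) : 'M[K]_n := ones K n *m r^T.
Definition JC (K : realType) n (c : 'cV[K]_n) : 'M[K]_n := c *m (ones K n)^T.

Definition rhoR (K : realType) n (R : 'M[K]_n) (r : 'cV[K]_n) : K :=
  opnorm2 (diag_sqrt r *m (R - JR r) *m invmx (diag_sqrt r)).

Definition rhoC (K : realType) n (C : 'M[K]_n) (c : 'cV[K]_n) : K :=
  opnorm2 (invmx (diag_sqrt c) *m (C - JC c) *m diag_sqrt c).

Definition dogt (K : realType) n m (f : 'I_n -> 'rV[K]_m -> K) (R C : 'M[K]_n)
    (alpha : K) (x y : nat -> 'M[K]_(n, m)) : Prop :=
  [/\ exists z : 'M[K]_(n, m), y 0%N = grad (Fc f) (x 0%N) + (C - 1%:M) *m z,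
      forall nu, x nu.+1 = R *m x nu - alpha *: y nu
    & forall nu, y nu.+1 =
        C *m y nu + grad (Fc f) (x nu.+1) - grad (Fc f) (x nu)].

Section Constants.
Context {K : realType} {n : nat}.
Implicit Types (R C : 'M[K]_n) (r c : 'cV[K]_n).
Implicit Types Lc LF alpha epsx epsy kappa : K.

Definition K_2R r : K := (Num.sqrt (vmin r))^-1.
Definition K_2C c : K := Num.sqrt (vmax c).
Definition K_C2 c : K := (Num.sqrt (vmin c))^-1.
Definition K_RC r c : K := Num.sqrt (vmax r * vmax c).

Definition K2 r c epsx : K := 2 * K_RC r c ^+ 2 * (1 + epsx^-1).
Definition K3 epsx : K := 2 * n%:R * (1 + epsx^-1).
Definition K4 c Lc : K := 3 * K_C2 c ^+ 2 * K_2C c ^+ 2 * Lc ^+ 2.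
Definition K5 c Lc : K := 3 * K_C2 c ^+ 2 * Lc ^+ 2.
Definition K6 r c Lc : K := 3 * K_C2 c ^+ 2 * K_2R r ^+ 2 * Lc ^+ 2.

Definition rhotR R r c Lc alpha epsx epsy (eps1 : K) kappa : K :=
  rhoR R r ^+ 2 * (1 + epsx)
  + alpha * n%:R * Lc ^+ 2 * K_2R r ^+ 2 / 2 * (1 + zeta r c / eps1)
  + kappa * K6 r c Lc * (1 + epsy^-1).

Definition rhotC C r c Lc LF alpha epsx epsy (eps1 : K) kappa : K :=
  rhoC C c ^+ 2 * (1 + epsy)
  + alpha * K_2C c ^+ 2 / (2 * kappa) * (1 + eps1^-1)
  + alpha ^+ 2 * ((LF * K_2C c ^+ 2 + K2 r c epsx) / kappa
                  + K4 c Lc * (1 + epsy^-1)).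

Definition Gammat r c Lc LF alpha epsx (eps1 : K) kappa : K :=
  (zeta r c - eps1 * zeta r c / 2 - eps1 / 2) * alpha
  - (LF * zeta r c ^+ 2 + K3 epsx + K5 c Lc * kappa) * alpha ^+ 2.

(* Since x / 0 = 0 in the library, for rhoR = 0 one gets epsx = 1/epsx = 0
   (similarly for rhoC and epsy): the inverse is the expected limit value.
   The bound on alpha alone does not give 0 < Gammat when Lc is small (and then
   the iteration may diverge), so this requirement on the step-size is stated
   explicitly; it follows from the other conditions when 1 <= Lc. *)
Definition explicit_step R C r c Lc LF alpha epsx epsy (eps1 : K) kappa : Prop :=
  let pR := 1 - rhoR R r ^+ 2 in
  let pC := 1 - rhoC C c ^+ 2 in
  [/\ epsx = pR / (4 * rhoR R r ^+ 2) /\ epsy = pC / (2 * rhoC C c ^+ 2),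
      eps1 = zeta r c / (1 + zeta r c),
      kappa = vmin c * vmin r / (24 * Lc ^+ 2) * pR * pC,
      0 < alpha <= pR ^+ 2 * pC ^+ 2 * vmin r ^+ 2 * vmin c ^+ 2
                   / (1152 * Lc ^+ 2 * (LF + 16 * n%:R))
    & 0 < Gammat r c Lc LF alpha epsx eps1 kappa].

(* The upper bounds (1 - rhoR^2) / (2 rhoR^2) and (1 - rhoC^2) / rhoC^2 on epsx
   and epsy are cleared of denominators, so that they read +oo, and not 0, when
   rhoR or rhoC vanishes. *)
Definition base_step R C r c Lc LF alpha epsx epsy (eps1 : K) kappa : Prop :=
  let z := zeta r c in
  [/\ 0 < epsx /\ epsx * (2 * rhoR R r ^+ 2) < 1 - rhoR R r ^+ 2,
      0 < epsy /\ epsy * rhoC C c ^+ 2 < 1 - rhoC C c ^+ 2,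
      0 < eps1 < 2 * z / (1 + z),
      0 < kappa <= rhoR R r ^+ 2 * epsx / (K6 r c Lc * (1 + epsy^-1))
    & [/\ 0 < alpha,
          alpha < 2 * (1 - rhoR R r ^+ 2 * (1 + 2 * epsx))
                  / (n%:R * Lc ^+ 2 * K_2R r ^+ 2 * (1 + z / eps1)),
          alpha < (1 - rhoC C c ^+ 2 * (1 + epsy))
                  / ((2 * kappa)^-1 * K_2C c ^+ 2 * (1 + eps1^-1 + 2 * LF)
                     + K2 r c epsx / kappa + K4 c Lc * (1 + epsy^-1))
        & alpha < (z - eps1 / 2 * (z + 1))
                  / (LF * z ^+ 2 + K3 epsx + K5 c Lc * kappa)]].

Definition dfun m (f : 'I_n -> 'rV[K]_m -> K) R C r c Lc LF
    alpha epsx epsy (eps1 : K) kappa (x y : 'M[K]_(n, m)) : K :=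
  Num.sqrt
    ((1 - rhotR R r c Lc alpha epsx epsy eps1 kappa)
       * normR r ((1%:M - JR r) *m x) ^+ 2
     + kappa * (1 - rhotC C r c Lc LF alpha epsx epsy eps1 kappa)
       * normC c ((1%:M - JC c) *m y) ^+ 2
     + Gammat r c Lc LF alpha epsx eps1 kappa
       * enorm (\sum_i grad (f i) (row i x)) ^+ 2).

End Constants.

Definition is_first (P : nat -> Prop) (t : nat) : Prop :=
  P t /\ forall nu, P nu -> (t <= nu)%N.

(* Main.v *)
Require Import Defs.
From HB Require Import structures.
From mathcomp Require Import all_boot all_order all_algebra.
From mathcomp Require Import all_classical all_reals all_analysis.
From mathcomp Require Import ring lra.
Set Implicit Arguments.
Unset Strict Implicit.
Unset Printing Implicit Defensive.
Import Order.TTheory GRing.Theory Num.Theory.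
Import numFieldNormedType.Exports.
Local Open Scope classical_set_scope.
Local Open Scope ring_scope.

(** The proof rests on a Lyapunov function. Three quantities measure how far the
    iteration is from a consensual stationary point: X, the squared r-norm of
    x - 1 (r^T x); Y, the squared c-norm of the part y - c (1^T y) of the
    tracker; and G = |1^T y|^2. The tracking invariant 1^T y = sum_i grad f_i(x_i)
    (ybar_tracking) makes G the size of the sum of the local gradients. The
    function V = F(r^T x) + 2 X + kappa Y loses at least delta (X + Y + G) in each
    step, for some delta > 0 (lyapunov_step), and F is bounded below because it is
    continuous and coercive. Hence X + Y + G is summable (summable_residuals).

    Everything follows from this. Consensus and the convergence of ybar are the
    convergence to 0 of X and G. At a limit point X and G vanish by continuity,
    which says that the point is of the form 1 (x) theta with grad F(theta) = 0.
    Finally d^2 <= M (X + Y + G), so that d^2 is summable, and the tails of a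
    convergent series give o(1 / eps^2) for the first time at which d <= eps
    (first_hit_rate).

    The decrease of V adds up three one-step estimates. The descent lemma for F at
    the mean iterate (objective_step) gains a multiple of -alpha G and loses
    multiples of X and Y. The disagreements of x and y contract by rhoR and rhoC,
    up to perturbations of order alpha or controlled by the increment of x
    (consensus_step, increment_le, tracking_step). That rhoR < 1 is the equality
    case of Jensen's inequality: averaging keeps the r-norm of a vector only if
    the vector is constant along the edges of the digraph, hence constant, and
    compactness of the unit ball makes the gap uniform (rhoR_lt1). That rhoC < 1
    is the same fact for the matrix diag(c)^-1 C diag(c).

    The conditions under which the coefficients of X, Y and G in the sum are
    negative are collected in admissible; each of the two step-size rules implies
    them. The weight 2 in front of X is what makes this work up to the largest
    steps: the increment of x contains (R - 1) x, whose r-norm can be nearly twice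
    that of the disagreement of x. The terms in alpha^2 have room to spare, since
    both rules force alpha <= 1/2. *)

(** * Weighted Frobenius norms *)

(** A stacked vector is stored as a matrix whose i-th row is its i-th block, so
    that the norms |.|_2, |.|_R and |.|_C are all instances of this one, with the
    weights 1, r_i and 1 / c_i. It is kept squared, as every estimate is. *)
Definition wsq (K : realType) p q (w : 'I_p -> K) (A : 'M[K]_(p, q)) : K :=
  \sum_i w i * \sum_j A i j ^+ 2.

Local Notation sq := (wsq (fun=> 1)).

Lemma wsq_ge0 (K : realType) p q (w : 'I_p -> K) (A : 'M[K]_(p, q)) :
  (forall i, 0 <= w i) -> 0 <= wsq w A.
Proof.
move=> w0; apply: sumr_ge0 => i _; apply: mulr_ge0 => //.
by apply: sumr_ge0 => j _; exact: sqr_ge0.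
Qed.

Lemma sq_ge0 (K : realType) p q (A : 'M[K]_(p, q)) : 0 <= sq A.
Proof. by apply: wsq_ge0 => i; exact: ler01. Qed.

Lemma sqE (K : realType) p q (A : 'M[K]_(p, q)) : sq A = \sum_i \sum_j A i j ^+ 2.
Proof. by apply: eq_bigr => i _; rewrite mul1r. Qed.

Lemma enorm_sqrt (K : realType) p q (A : 'M[K]_(p, q)) : enorm A = Num.sqrt (sq A).
Proof. by rewrite sqE. Qed.

Lemma enorm_sq (K : realType) p q (A : 'M[K]_(p, q)) : enorm A ^+ 2 = sq A.
Proof. by rewrite enorm_sqrt sqr_sqrtr// sq_ge0. Qed.

Lemma enorm_ge0 (K : realType) p q (A : 'M[K]_(p, q)) : 0 <= enorm A.
Proof. exact: sqrtr_ge0. Qed.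

Lemma ler_sqr_enorm (K : realType) p q p' q' (a : K)
    (A : 'M[K]_(p, q)) (B : 'M[K]_(p', q')) :
  enorm A <= a * enorm B -> sq A <= a ^+ 2 * sq B.
Proof.
move=> h; rewrite -!enorm_sq -exprMn ler_sqr// nnegrE ?enorm_ge0//.
exact: le_trans (enorm_ge0 _) h.
Qed.

Lemma ler_wsq (K : realType) p q (w w' : 'I_p -> K) (A : 'M[K]_(p, q)) :
  (forall i, w i <= w' i) -> wsq w A <= wsq w' A.
Proof.
move=> ww'; apply: ler_sum => i _; apply: ler_wpM2r => //.
by apply: sumr_ge0 => j _; exact: sqr_ge0.
Qed.

Lemma wsqM (K : realType) p q (a : K) (w : 'I_p -> K) (A : 'M[K]_(p, q)) :
  wsq (fun i => a * w i) A = a * wsq w A.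
Proof. by rewrite mulr_sumr; apply: eq_bigr => i _; rewrite mulrA. Qed.

Lemma wsqZ (K : realType) p q (w : 'I_p -> K) (a : K) (A : 'M[K]_(p, q)) :
  wsq w (a *: A) = a ^+ 2 * wsq w A.
Proof.
rewrite mulr_sumr; apply: eq_bigr => i _; rewrite mulrCA; congr (_ * _).
by rewrite mulr_sumr; apply: eq_bigr => j _; rewrite mxE exprMn.
Qed.

Lemma wsq0 (K : realType) p q (w : 'I_p -> K) : wsq w (0 : 'M[K]_(p, q)) = 0.
Proof. by have := wsqZ w 0 (0 : 'M[K]_(p, q)); rewrite scale0r expr0n mul0r. Qed.

Lemma wsqN (K : realType) p q (w : 'I_p -> K) (A : 'M[K]_(p, q)) :
  wsq w (- A) = wsq w A.
Proof. by rewrite -scaleN1r wsqZ sqrrN expr1n mul1r. Qed.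

Lemma sumr_le0_eq0 (K : realType) (I : finType) (g : I -> K) :
  (forall i, 0 <= g i) -> \sum_i g i <= 0 -> forall i, g i = 0.
Proof.
move=> g0 s0 i; apply/eqP; rewrite eq_le g0 andbT; apply: le_trans s0.
by rewrite (bigD1 i)//= lerDl sumr_ge0.
Qed.

Lemma wsq_eq0 (K : realType) p q (w : 'I_p -> K) (A : 'M[K]_(p, q)) :
  (forall i, 0 < w i) -> wsq w A <= 0 -> A = 0.
Proof.
move=> w0 h; apply/matrixP => i j; rewrite mxE; apply/eqP.
have s0 k : 0 <= \sum_l A k l ^+ 2 by apply: sumr_ge0 => l _; exact: sqr_ge0.
have ws0 k : 0 <= w k * \sum_l A k l ^+ 2 by rewrite mulr_ge0// ltW.
have /eqP := sumr_le0_eq0 ws0 h i; rewrite mulf_eq0 gt_eqF//= => /eqP si0.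
rewrite -sqrf_eq0; apply/eqP.
by move: j; apply: sumr_le0_eq0 => [l|]; [exact: sqr_ge0|rewrite si0].
Qed.

Lemma sq_entry (K : realType) p q (A : 'M[K]_(p, q)) i j : A i j ^+ 2 <= sq A.
Proof.
rewrite sqE (bigD1 i)//= (bigD1 j)//= -addrA lerDl addr_ge0//; apply: sumr_ge0 => k _.
  exact: sqr_ge0.
by apply: sumr_ge0 => l _; exact: sqr_ge0.
Qed.

Lemma young_sq (K : realType) (e a b : K) : 0 < e ->
  (a + b) ^+ 2 <= (1 + e) * a ^+ 2 + (1 + e^-1) * b ^+ 2.
Proof.
move=> e0; rewrite -subr_ge0.
have -> : (1 + e) * a ^+ 2 + (1 + e^-1) * b ^+ 2 - (a + b) ^+ 2 =
          e * (a - e^-1 * b) ^+ 2 by field; rewrite gt_eqF.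
by rewrite mulr_ge0 ?sqr_ge0 ?ltW.
Qed.

(** Young's inequality holds entry by entry, hence under any nonnegative weighting
    of the rows. *)
Lemma wsq_young (K : realType) p q (w : 'I_p -> K) (e : K) (A B : 'M[K]_(p, q)) :
  (forall i, 0 <= w i) -> 0 < e ->
  wsq w (A + B) <= (1 + e) * wsq w A + (1 + e^-1) * wsq w B.
Proof.
move=> w0 e0; rewrite /wsq (mulr_sumr _ _ _ (1 + e)) (mulr_sumr _ _ _ (1 + e^-1)).
rewrite -big_split/=; apply: ler_sum => i _.
rewrite mulrCA (mulrCA (1 + e^-1)) -mulrDr ler_wpM2l//.
rewrite (mulr_sumr _ _ _ (1 + e)) (mulr_sumr _ _ _ (1 + e^-1)) -big_split/=.
by apply: ler_sum => j _; rewrite mxE; exact: young_sq.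
Qed.

(** The gap in Jensen's inequality for the square is a variance: the inequality
    and its equality case both come from this identity. *)
Lemma weighted_variance (K : realType) (I : finType) (w a : I -> K) :
  \sum_i w i = 1 ->
  \sum_i w i * (a i - \sum_k w k * a k) ^+ 2 =
  \sum_i w i * a i ^+ 2 - (\sum_i w i * a i) ^+ 2.
Proof.
move=> w1; set mu := \sum_k w k * a k.
transitivity (\sum_i (w i * a i ^+ 2 - 2 * mu * (w i * a i) + mu ^+ 2 * w i)).
  by apply: eq_bigr => i _; ring.
by rewrite big_split sumrB/= -!mulr_sumr w1 -/mu; ring.
Qed.

Lemma jensen_sq (K : realType) (I : finType) (w a : I -> K) :
  (forall i, 0 <= w i) -> \sum_i w i = 1 ->
  (\sum_i w i * a i) ^+ 2 <= \sum_i w i * a i ^+ 2.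
Proof.
move=> w0 w1; rewrite -subr_ge0 -weighted_variance//; apply: sumr_ge0 => i _.
by rewrite mulr_ge0 ?sqr_ge0.
Qed.

Lemma sqr_sum_le (K : realType) n (a : 'I_n -> K) :
  (\sum_i a i) ^+ 2 <= n%:R * \sum_i a i ^+ 2.
Proof.
case: n a => [|n] a; first by rewrite big_ord0 expr0n mul0r.
have n0 : n.+1%:R != 0 :> K by rewrite pnatr_eq0.
have c0 : 0 <= n.+1%:R^-1 :> K by rewrite invr_ge0 ler0n.
have c1 : \sum_(i < n.+1) n.+1%:R^-1 = 1 :> K.
  by rewrite sumr_const card_ord -[LHS]mulr_natl divff.
have := jensen_sq a (fun=> c0) c1; rewrite -!mulr_sumr exprMn => h.
have := ler_wpM2l (ler0n K (n.+1 ^ 2)) h.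
rewrite natrX mulrA -exprMn mulfV// expr1n mul1r mulrA expr2.
by rewrite -(mulrA n.+1%:R) mulfV// mulr1.
Qed.

Lemma sq_mulmx_le (K : realType) p q m (M : 'M[K]_(p, q)) (A : 'M[K]_(q, m)) :
  sq (M *m A) <= (q%:R * sq M) * sq A.
Proof.
have h i j : (M *m A) i j ^+ 2 <= q%:R * \sum_k M i k ^+ 2 * A k j ^+ 2.
  rewrite mxE; apply: le_trans (sqr_sum_le _) _.
  by apply: ler_wpM2l => //; apply: ler_sum => k _; rewrite exprMn.
have h1 : sq (M *m A) <= \sum_i \sum_j q%:R * \sum_k M i k ^+ 2 * A k j ^+ 2.
  by rewrite sqE; apply: ler_sum => i _; apply: ler_sum => j _.
apply: le_trans h1 _; rewrite (sqE M) -mulrA mulrCA mulr_suml.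
apply: ler_sum => i _; rewrite -mulr_sumr mulrCA; apply: ler_wpM2l => //.
rewrite exchange_big/= mulr_suml; apply: ler_sum => k _.
rewrite -mulr_sumr; apply: ler_wpM2l; first exact: sqr_ge0.
rewrite sqE (bigD1 k)//= lerDl; apply: sumr_ge0 => l _.
by apply: sumr_ge0 => j _; exact: sqr_ge0.
Qed.

Lemma mul_onesE (K : realType) n m (A : 'M[K]_(n, m)) i j :
  ((ones K n)^T *m A) i j = \sum_k A k j.
Proof. by rewrite mxE; apply: eq_bigr => k _; rewrite /ones !mxE mul1r. Qed.

Lemma ones_mulE (K : realType) n m (t : 'rV[K]_m) i j :
  (ones K n *m t) i j = t 0 j.
Proof. by rewrite mxE big_ord1 /ones mxE mul1r. Qed.

Lemma sq_mul_ones (K : realType) n m (A : 'M[K]_(n, m)) :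
  sq ((ones K n)^T *m A) <= n%:R * sq A.
Proof.
rewrite !sqE big_ord1 exchange_big/= mulr_sumr; apply: ler_sum => j _.
by rewrite mul_onesE; exact: sqr_sum_le.
Qed.

(** * The spectral norm *)

Lemma diag_sqrt_mulE (K : realType) n m (v : 'cV[K]_n) (A : 'M[K]_(n, m)) i j :
  (diag_sqrt v *m A) i j = Num.sqrt (v i 0) * A i j.
Proof. by rewrite /diag_sqrt mul_diag_mx !mxE. Qed.

Lemma invmx_diag_sqrt (K : realType) n (v : 'cV[K]_n) : (forall i, 0 < v i 0) ->
  diag_sqrt v \in unitmx /\
  invmx (diag_sqrt v) = diag_mx (\row_i (Num.sqrt (v i 0))^-1).
Proof.
move=> v0.
have h : diag_sqrt v *m diag_mx (\row_i (Num.sqrt (v i 0))^-1) = 1%:M.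
  apply/matrixP => i j; rewrite diag_sqrt_mulE !mxE.
  case: eqP => [->|]; last by rewrite !mulr0n mulr0.
  by rewrite !mulr1n mulfV// gt_eqF// sqrtr_gt0.
have [u _] := mulmx1_unit h; split=> //.
by rewrite -[RHS]mul1mx -(mulVmx u) -mulmxA h mulmx1.
Qed.

Lemma invmx_diag_sqrt_mulE (K : realType) n m (v : 'cV[K]_n) (A : 'M[K]_(n, m)) i j :
  (forall i, 0 < v i 0) ->
  (invmx (diag_sqrt v) *m A) i j = (Num.sqrt (v i 0))^-1 * A i j.
Proof. by move=> v0; rewrite (invmx_diag_sqrt v0).2 mul_diag_mx !mxE. Qed.

Lemma normR_sq (K : realType) n m (r : 'cV[K]_n) (x : 'M[K]_(n, m)) :
  (forall i, 0 < r i 0) -> normR r x ^+ 2 = wsq (fun i => r i 0) x.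
Proof.
move=> r0; rewrite /normR enorm_sq sqE; apply: eq_bigr => i _.
rewrite mulr_sumr; apply: eq_bigr => j _.
by rewrite diag_sqrt_mulE exprMn sqr_sqrtr// ltW.
Qed.

Lemma normC_sq (K : realType) n m (c : 'cV[K]_n) (y : 'M[K]_(n, m)) :
  (forall i, 0 < c i 0) -> normC c y ^+ 2 = wsq (fun i => (c i 0)^-1) y.
Proof.
move=> c0; rewrite /normC enorm_sq sqE; apply: eq_bigr => i _.
rewrite mulr_sumr; apply: eq_bigr => j _.
by rewrite invmx_diag_sqrt_mulE// exprMn exprVn sqr_sqrtr// ltW.
Qed.

Lemma enormZ (K : realType) p q (a : K) (A : 'M[K]_(p, q)) :
  enorm (a *: A) = `|a| * enorm A.
Proof. by rewrite !enorm_sqrt wsqZ sqrtrM ?sqr_ge0// sqrtr_sqr. Qed.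

Lemma sq_cols (K : realType) p q (A : 'M[K]_(p, q)) : sq A = \sum_j sq (col j A).
Proof.
rewrite sqE exchange_big; apply: eq_bigr => j _; rewrite sqE.
by apply: eq_bigr => i _; rewrite big_ord1 mxE.
Qed.

(** The supremum defining the spectral norm is over a nonempty set bounded by a
    multiple of the Frobenius norm, so that it is a genuine least upper bound. *)
Lemma opnorm2_has_sup (K : realType) n (M : 'M[K]_n) :
  has_sup [set enorm (M *m v) | v in [set v : 'cV[K]_n | enorm v <= 1]].
Proof.
split.
  by exists (enorm (M *m (0 : 'cV_n))), 0; rewrite //= enorm_sqrt wsq0 sqrtr0.
exists (Num.sqrt (n%:R * sq M)) => _ [v /= v1 <-].
rewrite enorm_sqrt ler_wsqrtr//; apply: le_trans (sq_mulmx_le _ _) _.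
rewrite ler_piMr ?mulr_ge0 ?sq_ge0// -enorm_sq.
by rewrite expr_le1// enorm_ge0.
Qed.

Lemma opnorm2_ge0 (K : realType) n (M : 'M[K]_n) : 0 <= opnorm2 M.
Proof.
have [_ ub] := opnorm2_has_sup M.
apply: le_trans (enorm_ge0 (M *m (0 : 'cV_n))) (ub_le_sup ub _).
by exists 0; rewrite //= enorm_sqrt wsq0 sqrtr0.
Qed.

(** A matrix acts on the columns of A independently, so the bound for vectors
    extends to stacked vectors. *)
Lemma opnorm2P (K : realType) n m (M : 'M[K]_n) (A : 'M[K]_(n, m)) :
  sq (M *m A) <= opnorm2 M ^+ 2 * sq A.
Proof.
have [_ ub] := opnorm2_has_sup M.
rewrite sq_cols (sq_cols A) mulr_sumr; apply: ler_sum => j _.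
rewrite colE -mulmxA -colE; set v := col j A; apply: ler_sqr_enorm.
have [v0|v0] := eqVneq (enorm v) 0.
  have -> : v = 0.
    by apply: (@wsq_eq0 _ _ _ (fun=> 1)) => //; rewrite -enorm_sq v0 expr0n.
  by rewrite mulmx0 enorm_sqrt wsq0 sqrtr0 mulr_ge0 ?opnorm2_ge0 ?enorm_ge0.
have vp : 0 < enorm v by rewrite lt_def v0 enorm_ge0.
have : enorm (M *m ((enorm v)^-1 *: v)) <= opnorm2 M.
  apply: (ub_le_sup ub); exists ((enorm v)^-1 *: v) => //=.
  by rewrite enormZ gtr0_norm ?invr_gt0// mulVf.
by rewrite -scalemxAr enormZ gtr0_norm ?invr_gt0// ler_pdivrMl// mulrC.
Qed.

Lemma sq_tr (K : realType) p q (A : 'M[K]_(p, q)) : sq A^T = sq A.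
Proof.
rewrite !sqE exchange_big; apply: eq_bigr => i _; apply: eq_bigr => j _.
by rewrite mxE.
Qed.

Lemma continuous_sum (K : realType) (T : topologicalType) (I : Type) (s : seq I)
    (g : I -> T -> K) :
  (forall i, continuous (g i)) -> continuous (fun x => \sum_(i <- s) g i x).
Proof.
move=> cg x; elim: s => [|i s IH].
  by under eq_fun do rewrite big_nil; exact: cvg_cst.
by under eq_fun do rewrite big_cons; apply: cvgD => //; exact: cg.
Qed.

Lemma continuous_sq_comp (K : realType) (T : topologicalType) p q (g : T -> 'M[K]_(p, q)) :
  (forall i j, continuous (fun x => g x i j)) -> continuous (fun x => sq (g x)).
Proof.
move=> cg; under eq_fun do rewrite sqE.
apply: continuous_sum => i; apply: continuous_sum => j x.
by under eq_fun do rewrite expr2; apply: cvgM; exact: cg.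
Qed.

Lemma continuous_mulmx_entry (K : realType) (T : topologicalType) p q l
    (M : 'M[K]_(p, q)) (g : T -> 'M[K]_(q, l)) :
  (forall i j, continuous (fun x => g x i j)) ->
  forall i j, continuous (fun x => (M *m g x) i j).
Proof.
move=> cg i j; under eq_fun do rewrite mxE.
by apply: continuous_sum => k x; apply: cvgM; [exact: cvg_cst|exact: cg].
Qed.

Lemma norm_le_enorm (K : realType) p q (A : 'M[K]_(p, q)) : `|A| <= enorm A.
Proof.
rewrite [leLHS]/Num.norm /= mx_normrE; apply: bigmax_le; first exact: enorm_ge0.
move=> [i j] _ /=; rewrite -sqrtr_sqr enorm_sqrt ler_wsqrtr//; exact: sq_entry.
Qed.

(** Compactness is available for bounded sets of the sup norm, which the Euclidean
    norm dominates. *)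
Lemma compact_eball (K : realType) m (B : K) :
  compact [set w : 'rV[K]_m | sq w <= B].
Proof.
apply: bounded_closed_compact.
  exists (Num.sqrt B); split; first exact: num_real.
  move=> x Bx w /= wB; apply: le_trans (norm_le_enorm _) _.
  by apply: le_trans (ltW Bx); rewrite enorm_sqrt ler_wsqrtr.
apply: (preimage_closed (f := fun w : 'rV[K]_m => sq w) (D := [set x | x <= B])).
  by move=> w _; apply: continuous_sq_comp => i j; exact: coord_continuous.
exact: closed_le.
Qed.

(** On the compact unit ball the supremum is attained, so that a strict decrease
    of every nonzero vector yields a strict bound. *)
Lemma opnorm2_lt1 (K : realType) n (M : 'M[K]_n) :
  (forall v : 'cV[K]_n, v != 0 -> sq (M *m v) < sq v) -> opnorm2 M < 1.
Proof.
move=> Mv.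
have [w wB wmax] : exists2 w : 'rV[K]_n, w \in [set w : 'rV[K]_n | sq w <= 1] &
   forall t, t \in [set w : 'rV[K]_n | sq w <= 1] -> sq (M *m t^T) <= sq (M *m w^T).
  apply: EVT_max_rV.
  - by exists 0; rewrite /= wsq0.
  - exact: compact_eball.
  - apply: continuous_subspaceT; apply: continuous_sq_comp.
    apply: continuous_mulmx_entry => i j.
    by under eq_fun do rewrite mxE; exact: coord_continuous.
have {}wB : sq w <= 1 by rewrite inE in wB.
have lt1 : sq (M *m w^T) < 1.
  have [->|w0] := eqVneq w 0; first by rewrite trmx0 mulmx0 wsq0.
  apply: lt_le_trans (Mv _ _) _; last by rewrite sq_tr.
  by rewrite -trmx0 (inj_eq trmx_inj).
apply: (@le_lt_trans _ _ (Num.sqrt (sq (M *m w^T)))); last first.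
  by rewrite -[ltRHS]sqrtr1 ltr_sqrt.
apply: ge_sup; first by have [] := opnorm2_has_sup M.
move=> _ [v /= v1 <-]; rewrite enorm_sqrt ler_wsqrtr//.
rewrite -{1}(trmxK v); apply: wmax; rewrite inE /= sq_tr -enorm_sq.
by rewrite expr_le1// enorm_ge0.
Qed.

(** * Contraction factors of stochastic matrices *)

Lemma mul_subJR (K : realType) n m (r : 'cV[K]_n) (x : 'M[K]_(n, m)) i j :
  ((1%:M - JR r) *m x) i j = x i j - \sum_k r k 0 * x k j.
Proof.
rewrite mulmxBl mul1mx /JR -mulmxA mxE [X in _ + X]mxE ones_mulE mxE.
by congr (_ - _); apply: eq_bigr => k _; rewrite mxE.
Qed.

(** Subtracting the r-weighted mean is the orthogonal projection for the
    r-weighted inner product, whence a Pythagorean identity. *)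
Lemma wsq_subJR (K : realType) n m (r : 'cV[K]_n) (x : 'M[K]_(n, m)) :
  \sum_i r i 0 = 1 ->
  wsq (fun i => r i 0) ((1%:M - JR r) *m x) =
  wsq (fun i => r i 0) x - sq (r^T *m x).
Proof.
move=> r1; rewrite sqE big_ord1 /wsq.
under eq_bigr do rewrite mulr_sumr; rewrite exchange_big/=.
under [X in _ = X - _]eq_bigr do rewrite mulr_sumr.
rewrite [X in _ = X - _]exchange_big/= -sumrB; apply: eq_bigr => j _.
under eq_bigr do rewrite mul_subJR.
rewrite weighted_variance//; congr (_ - _ ^+ 2).
by rewrite mxE; apply: eq_bigr => k _; rewrite mxE.
Qed.

Lemma row_stochastic_sum (K : realType) n (R : 'M[K]_n) i :
  row_stochastic R -> \sum_k R i k = 1.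
Proof.
move=> [_ /matrixP/(_ i 0)]; rewrite /ones !mxE => h; rewrite -[RHS]h.
by apply: eq_bigr => k _; rewrite mxE mulr1.
Qed.

Lemma left_fixed_sum (K : realType) n (R : 'M[K]_n) (r : 'cV[K]_n) j :
  r^T *m R = r^T -> \sum_i r i 0 * R i j = r j 0.
Proof.
move=> /matrixP/(_ 0 j); rewrite !mxE => h; rewrite -[RHS]h.
by apply: eq_bigr => k _; rewrite mxE.
Qed.

(** Each row of R x is an average of the rows of x. The variances of these averages
    are exactly what the r-norm loses, because r is invariant. *)
Lemma wsq_averaging (K : realType) n (R : 'M[K]_n) (r x : 'cV[K]_n) :
  row_stochastic R -> r^T *m R = r^T -> 
  wsq (fun i => r i 0) (R *m x) +
    \sum_i r i 0 * \sum_k R i k * (x k 0 - (R *m x) i 0) ^+ 2 =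
  wsq (fun i => r i 0) x.
Proof.
move=> Rs rR; rewrite /wsq -big_split/=.
under eq_bigr => i _.
  rewrite -mulrDr big_ord1 mxE weighted_variance ?row_stochastic_sum// addrC subrK mulr_sumr.
  over.
rewrite exchange_big/=; apply: eq_bigr => k _.
rewrite big_ord1 -[in RHS](left_fixed_sum k rR) mulr_suml.
by apply: eq_bigr => i _; rewrite mulrA.
Qed.

(** If nothing is lost, then all the variances vanish: the entries averaged in row
    i agree, and as R i i > 0 their common value is x i. *)
Lemma averaging_gap0 (K : realType) n (R : 'M[K]_n) (r x : 'cV[K]_n) :
  row_stochastic R -> (forall i, 0 < R i i) -> r^T *m R = r^T ->
  (forall i, 0 < r i 0) ->
  wsq (fun i => r i 0) x <= wsq (fun i => r i 0) (R *m x) ->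
  forall i k, 0 < R i k -> x k 0 = x i 0.
Proof.
move=> Rs Rd rR r0; rewrite -(wsq_averaging x Rs rR) gerDl => gap.
have R0 i k : 0 <= R i k by have [R0 _] := Rs; exact: R0.
have t0 i k : 0 <= R i k * (x k 0 - (R *m x) i 0) ^+ 2.
  by rewrite mulr_ge0 ?sqr_ge0.
have s0 i : 0 <= \sum_k R i k * (x k 0 - (R *m x) i 0) ^+ 2 by exact: sumr_ge0.
have rs0 i : 0 <= r i 0 * \sum_k R i k * (x k 0 - (R *m x) i 0) ^+ 2.
  by apply: mulr_ge0 => //; exact: ltW.
have eq0 i k : 0 < R i k -> x k 0 = (R *m x) i 0.
  move=> Rik; have /eqP := sumr_le0_eq0 rs0 gap i.
  rewrite mulf_eq0 gt_eqF//= => /eqP si0.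
  have /eqP : R i k * (x k 0 - (R *m x) i 0) ^+ 2 = 0.
    by apply: (sumr_le0_eq0 (t0 i)); rewrite si0.
  by rewrite mulf_eq0 gt_eqF//= sqrf_eq0 subr_eq0 => /eqP.
by move=> i k Rik; rewrite (eq0 i k)// (eq0 i i).
Qed.

Lemma subJR_mul (K : realType) n (R : 'M[K]_n) (r : 'cV[K]_n) :
  row_stochastic R -> r^T *m R = r^T -> \sum_i r i 0 = 1 ->
  R - JR r = R *m (1%:M - JR r) /\ R - JR r = (1%:M - JR r) *m R.
Proof.
move=> [_ R1] rR r1; rewrite mulmxBr mulmxBl mulmx1 mul1mx /JR mulmxA R1.
by rewrite -mulmxA rR.
Qed.

(** Connectedness is expressed through functions that are constant along edges: in
    this form it ignores the direction of the edges and is immediate to apply to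
    the coordinates of a vector. *)
Definition connected_digraph (V : finType) (E : rel V) : Prop :=
  forall (T : Type) (g : V -> T), (forall i j, E i j -> g i = g j) ->
  forall i j, g i = g j.

Lemma tree_connected (V : finType) (E : rel V) :
  tree_roots E !=set0 -> connected_digraph E.
Proof.
move=> [k [T [sTE hT]]] A g gE.
suff gk v : g v = g k by move=> i j; rewrite !gk.
have [p [[Tp <-] _]] := hT v.
elim: p k Tp {hT v} => //= u p IH k /andP[/sTE /gE -> Tp]; exact: IH.
Qed.

(** A vector whose r-norm R - 1 r^T does not decrease has mean 0, since the
    projection keeps its norm, and is constant along the edges, since averaging
    does; being constant of mean 0, it vanishes. *)
Lemma rhoR_lt1 (K : realType) n (R : 'M[K]_n) (r : 'cV[K]_n) :
  row_stochastic R -> (forall i, 0 < R i i) -> connected_digraph (digraph_of R) ->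
  r^T *m R = r^T -> \sum_i r i 0 = 1 -> (forall i, 0 < r i 0) ->
  rhoR R r < 1.
Proof.
move=> Rs Rd Rc rR r1 r0; apply: opnorm2_lt1 => v v0.
have [uS _] := invmx_diag_sqrt r0.
set u := invmx (diag_sqrt r) *m v.
have vE : v = diag_sqrt r *m u by rewrite mulmxA mulmxV ?mul1mx.
have u0 : u != 0 by apply: contra_neq v0; rewrite vE => ->; rewrite mulmx0.
have toR (z : 'cV_n) : sq (diag_sqrt r *m z) = wsq (fun i => r i 0) z.
  by rewrite -enorm_sq; exact: normR_sq.
rewrite -!mulmxA -/u [in ltRHS]vE !toR (subJR_mul Rs rR r1).1 -mulmxA.
have avg := wsq_averaging ((1%:M - JR r) *m u) Rs rR.
have proj := wsq_subJR u r1.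
set x := (1%:M - JR r) *m u in avg proj *.
have le1 : wsq (fun i => r i 0) (R *m x) <= wsq (fun i => r i 0) x.
  rewrite -avg lerDl; apply: sumr_ge0 => i _; apply: mulr_ge0; first exact: ltW.
  by apply: sumr_ge0 => k _; rewrite mulr_ge0 ?sqr_ge0//; have [] := Rs.
have le2 : wsq (fun i => r i 0) x <= wsq (fun i => r i 0) u.
  by rewrite proj gerBl sq_ge0.
rewrite lt_neqAle (le_trans le1 le2) andbT; apply/eqP => eq1.
have ru0 : r^T *m u = 0.
  apply: (@wsq_eq0 _ _ _ (fun=> 1)) => //.
  have : wsq (fun i => r i 0) u <= wsq (fun i => r i 0) x by rewrite -eq1.
  by rewrite proj lerBrDr gerDl.
have xu : x = u by rewrite /x mulmxBl mul1mx /JR -mulmxA ru0 mulmx0 subr0.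
have gap : wsq (fun i => r i 0) x <= wsq (fun i => r i 0) (R *m x) by rewrite eq1.
have cst i j : x i 0 = x j 0.
  apply: (Rc _ (fun i => x i 0)) => k l /= Rkl.
  exact: averaging_gap0 Rs Rd rR r0 gap _ _ Rkl.
clearbody x; case/eqP: u0; apply/matrixP => i j; rewrite ord1 [RHS]mxE -xu.
have /matrixP/(_ 0 0) := ru0; rewrite -xu !mxE.
under eq_bigr do rewrite mxE (cst _ i).
by rewrite -mulr_suml r1 mul1r.
Qed.

(** This is diag(c)^-1 C diag(c), which is row-stochastic with left fixed vector c
    and has the same edges as C. *)
Definition col_to_row (K : realType) n (C : 'M[K]_n) (c : 'cV[K]_n) : 'M[K]_n :=
  \matrix_(i, j) ((c i 0)^-1 * C i j * c j 0).

Lemma col_to_row_stochastic (K : realType) n (C : 'M[K]_n) (c : 'cV[K]_n) :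
  col_stochastic C -> C *m c = c -> (forall i, 0 < c i 0) ->
  row_stochastic (col_to_row C c) /\ c^T *m col_to_row C c = c^T.
Proof.
move=> [C0 C1] Cc c0; split; first split.
- move=> i j; rewrite mxE mulr_ge0 ?mulr_ge0 ?invr_ge0//; exact: ltW.
- apply/matrixP => i j; rewrite /ones !mxE.
  under eq_bigr do rewrite !mxE mulr1 -mulrA.
  have /matrixP/(_ i 0) := Cc; rewrite mxE -mulr_sumr => ->.
  by rewrite mulVf// gt_eqF.
- apply/matrixP => i j; rewrite !mxE ord1.
  under eq_bigr do rewrite !mxE -mulrA mulVKf ?gt_eqF//.
  have /matrixP/(_ 0 j) := C1; rewrite mul_onesE /ones !mxE => C1j.
  by rewrite -mulr_suml C1j mul1r.
Qed.

(** As diag(sqrt c) = diag(sqrt c)^-1 diag(c), conjugating C by diag(c) exchanges the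
    two scalings, and both contraction factors are the norm of one matrix. *)
Lemma rhoC_rhoR (K : realType) n (C : 'M[K]_n) (c : 'cV[K]_n) :
  (forall i, 0 < c i 0) -> rhoC C c = rhoR (col_to_row C c) c.
Proof.
move=> c0; congr opnorm2; apply/matrixP => i j.
rewrite (invmx_diag_sqrt c0).2 /diag_sqrt !mul_mx_diag !mul_diag_mx.
rewrite /JC /JR /ones !mxE !big_ord1 !mxE mulr1 mul1r.
have si : Num.sqrt (c i 0) != 0 by rewrite gt_eqF// sqrtr_gt0.
have sj : Num.sqrt (c j 0) != 0 by rewrite gt_eqF// sqrtr_gt0.
have : c i 0 = Num.sqrt (c i 0) ^+ 2 by rewrite sqr_sqrtr// ltW.
have : c j 0 = Num.sqrt (c j 0) ^+ 2 by rewrite sqr_sqrtr// ltW.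
move: si sj; move: (Num.sqrt (c i 0)) (Num.sqrt (c j 0)) => a b a0 b0 -> ->.
by field; rewrite a0 b0.
Qed.

Lemma rhoC_lt1 (K : realType) n (C : 'M[K]_n) (c : 'cV[K]_n) :
  col_stochastic C -> (forall i, 0 < C i i) -> connected_digraph (digraph_of C^T) ->
  C *m c = c -> \sum_i c i 0 = 1 -> (forall i, 0 < c i 0) ->
  rhoC C c < 1.
Proof.
move=> Cs Cd Cc Cfix c1 c0; rewrite rhoC_rhoR//.
have [Rs cR] := col_to_row_stochastic Cs Cfix c0.
apply: rhoR_lt1 => //.
  by move=> i; rewrite mxE !mulr_gt0 ?invr_gt0.
move=> T g gE; apply: Cc => i j; rewrite /digraph_of /= mxE => Cji; apply/esym/gE.
by rewrite /digraph_of /= mxE !mulr_gt0 ?invr_gt0.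
Qed.

(** In the coordinates diag(sqrt r) x the r-norm becomes Euclidean, and rhoR is by
    definition the norm of R - 1 r^T in them. *)
Lemma rhoR_contraction (K : realType) n m (R : 'M[K]_n) (r : 'cV[K]_n)
    (x : 'M[K]_(n, m)) : (forall i, 0 < r i 0) ->
  wsq (fun i => r i 0) ((R - JR r) *m x) <= rhoR R r ^+ 2 * wsq (fun i => r i 0) x.
Proof.
move=> r0; rewrite -!normR_sq// /normR !enorm_sq.
have [uS _] := invmx_diag_sqrt r0.
rewrite [leLHS](_ : _ = sq ((diag_sqrt r *m (R - JR r) *m invmx (diag_sqrt r))
  *m (diag_sqrt r *m x))); first exact: opnorm2P.
by congr wsq; rewrite -!mulmxA (mulmxA (invmx _)) mulVmx// mul1mx.
Qed.

Lemma rhoC_contraction (K : realType) n m (C : 'M[K]_n) (c : 'cV[K]_n)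
    (y : 'M[K]_(n, m)) : (forall i, 0 < c i 0) ->
  wsq (fun i => (c i 0)^-1) ((C - JC c) *m y) <=
  rhoC C c ^+ 2 * wsq (fun i => (c i 0)^-1) y.
Proof.
move=> c0; rewrite -!normC_sq// /normC !enorm_sq.
have [uS _] := invmx_diag_sqrt c0.
rewrite [leLHS](_ : _ = sq ((invmx (diag_sqrt c) *m (C - JC c) *m diag_sqrt c)
  *m (invmx (diag_sqrt c) *m y))); first exact: opnorm2P.
by congr wsq; rewrite -!mulmxA (mulmxA (diag_sqrt c)) mulmxV// mul1mx.
Qed.

Lemma mul_subJC (K : realType) n m (c : 'cV[K]_n) (y : 'M[K]_(n, m)) i j :
  ((1%:M - JC c) *m y) i j = y i j - c i 0 * \sum_k y k j.
Proof.
rewrite mulmxBl mul1mx /JC -mulmxA mxE [X in _ + X]mxE mxE big_ord1.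
by rewrite mul_onesE.
Qed.

(** Subtracting c (1^T y) is the orthogonal projection for the c-weighted inner
    product, as c is orthogonal in it to the vectors of zero sum. *)
Lemma wsq_subJC_le (K : realType) n m (c : 'cV[K]_n) (y : 'M[K]_(n, m)) :
  \sum_i c i 0 = 1 -> (forall i, 0 < c i 0) ->
  wsq (fun i => (c i 0)^-1) ((1%:M - JC c) *m y) <= wsq (fun i => (c i 0)^-1) y.
Proof.
move=> c1 c0; rewrite -subr_ge0 /wsq.
under eq_bigr do rewrite mulr_sumr; rewrite exchange_big/=.
under [X in 0 <= _ - X]eq_bigr do rewrite mulr_sumr.
rewrite [X in 0 <= _ - X]exchange_big/= -sumrB; apply: sumr_ge0 => j _.
under [X in 0 <= _ - X]eq_bigr do rewrite mul_subJC.
set s := \sum_k y k j.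
rewrite [X in 0 <= _ - X](_ : _ =
  \sum_i ((c i 0)^-1 * y i j ^+ 2 - 2 * s * y i j + s ^+ 2 * c i 0)); last first.
  by apply: eq_bigr => i _; field; rewrite gt_eqF.
rewrite big_split sumrB/= -!mulr_sumr c1 -/s.
rewrite (_ : _ - _ = s ^+ 2) ?sqr_ge0//; ring.
Qed.

(** * Gradients, the descent lemma and coercivity *)

Lemma derive_along (K : realType) (V : normedModType K) (g : V -> K) (x v : V) (t : K) :
  differentiable g (x + t *: v) ->
  is_derive t 1 (fun t => g (x + t *: v)) ('D_v g (x + t *: v)).
Proof.
move=> dg.
have E : (fun h : K => h^-1 *: (((fun t => g (x + t *: v)) \o shift t) (h *: 1) -
    g (x + t *: v))) =
  (fun h : K => h^-1 *: ((g \o shift (x + t *: v)) (h *: v) - g (x + t *: v))).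
  apply/funext => h /=; rewrite (_ : h *: 1 = h); last exact: mulr1.
  by rewrite scalerDl addrCA.
split; last by rewrite /derive E.
by rewrite /derivable E; exact: diff_derivable.
Qed.

Lemma matrix_delta_sum (K : realType) m (v : 'rV[K]_m) :
  v = \sum_j v 0 j *: delta_mx 0 j.
Proof. by rewrite {1}[v]matrix_sum_delta big_ord1. Qed.

Lemma derive_grad (K : realType) m (g : 'rV[K]_m -> K) (x v : 'rV[K]_m) :
  differentiable g x -> 'D_v g x = \sum_j grad g x 0 j * v 0 j.
Proof.
move=> dg; rewrite deriveE// [in LHS](matrix_delta_sum v) linear_sum.
by apply: eq_bigr => j _; rewrite linearZ mxE deriveE// mulrC.
Qed.

Lemma grad_Fsum (K : realType) n m (f : 'I_n -> 'rV[K]_m -> K) (x : 'rV[K]_m) :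
  (forall i, differentiable (f i) x) -> grad (Fsum f) x = \sum_i grad (f i) x.
Proof.
move=> df; apply/matrixP => i j; rewrite summxE mxE.
have -> : Fsum f = \sum_i f i by apply/funext => y; rewrite fct_sumE.
rewrite derive_sum => [|k]; last exact: diff_derivable.
by apply: eq_bigr => k _; rewrite mxE.
Qed.

(** The difference quotients of X |-> g (row k X) at X are literally those of g at
    row k X. *)
Lemma row_comp_derive (K : realType) n m (g : 'rV[K]_m -> K) (k : 'I_n)
    (X v : 'M[K]_(n, m)) :
  'D_v (fun X => g (row k X)) X = 'D_(row k v) g (row k X) /\
  (derivable g (row k X) (row k v) -> derivable (fun X => g (row k X)) X v).
Proof.
have E : (fun h : K => h^-1 *: (((fun X => g (row k X)) \o shift X) (h *: v) -
    g (row k X))) =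
  (fun h : K => h^-1 *: ((g \o shift (row k X)) (h *: row k v) - g (row k X))).
  apply/funext => h /=; congr (_ *: (g _ - _)).
  by apply/rowP => j; rewrite !mxE.
by split; rewrite ?/derive ?/derivable E.
Qed.

Lemma grad_Fc (K : realType) n m (f : 'I_n -> 'rV[K]_m -> K) (X : 'M[K]_(n, m)) i j :
  (forall k x, differentiable (f k) x) ->
  grad (Fc f) X i j = grad (f i) (row i X) 0 j.
Proof.
move=> df; rewrite mxE.
have -> : Fc f = \sum_k (fun X => f k (row k X)).
  by apply/funext => y; rewrite fct_sumE.
rewrite derive_sum => [|k]; last first.
  by apply: (row_comp_derive _ _ _ _).2; exact: diff_derivable.
rewrite (bigD1 i)//= big1 => [|k ki]; rewrite (row_comp_derive _ _ _ _).1.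
  rewrite addr0 mxE; congr (derive _ _ _).
  by apply/rowP => l; rewrite !mxE eqxx.
rewrite derive_grad// big1// => l _.
by rewrite !mxE (negbTE ki) mulr0.
Qed.

(** The Cauchy-Schwarz inequality, in the form in which a Lipschitz bound on
    squared norms feeds it. *)
Lemma dot_le (K : realType) m (s : K) (a b : 'rV[K]_m) :
  0 <= s -> sq a <= s ^+ 2 * sq b -> \sum_j a 0 j * b 0 j <= s * sq b.
Proof.
rewrite le_eqVlt => /predU1P[<-|s0].
  rewrite expr0n mul0r => /(wsq_eq0 (fun _ => ltr01)) ->.
  by rewrite big1// => j _; rewrite mxE mul0r.
move=> ab; apply: (@le_trans _ _ ((2 * s)^-1 * sq a + s / 2 * sq b)).
  rewrite !sqE !big_ord1 !mulr_sumr -big_split/=; apply: ler_sum => j _.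
  rewrite -subr_ge0.
  rewrite (_ : _ - _ = (2 * s)^-1 * (a 0 j - s * b 0 j) ^+ 2); last first.
    by field; rewrite gt_eqF.
  by rewrite mulr_ge0 ?sqr_ge0// invr_ge0 mulr_ge0// ltW.
have -> : s * sq b = (2 * s)^-1 * (s ^+ 2 * sq b) + s / 2 * sq b.
  by field; rewrite gt_eqF.
by rewrite lerD2r ler_wpM2l// invr_ge0 mulr_ge0// ltW.
Qed.

Lemma mxBE (K : realType) p q (A B : 'M[K]_(p, q)) i j :
  (A - B) i j = A i j - B i j.
Proof. by rewrite !mxE. Qed.

Lemma is_derive_quad (K : realType) (t d a : K) :
  is_derive t (1 : K) (fun t : K => t * d + a * t ^+ 2) (d + a * (2 * t)).
Proof.
have -> : (fun t : K => t * d + a * t ^+ 2) = d \*: (@id K) + a \*: (@id K ^+ 2).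
  by apply/funext => u /=; rewrite /GRing.scale /= mulrC.
apply: is_derive_eq.
by rewrite /GRing.scale /= !mulr1 expr1.
Qed.

(** The excess of g over its quadratic model has a nonpositive derivative along
    the segment, because the gradient moves by at most L t |v| at time t. The
    factor 1/2 matters: the term LF zeta^2 in the bounds on alpha leaves no room
    for twice this quadratic term. *)
Lemma descent_lemma (K : realType) m (g : 'rV[K]_m -> K) (L : K) (x v : 'rV[K]_m) :
  (forall x, differentiable g x) -> 0 <= L -> elipschitz L (grad g) ->
  g (x + v) <= g x + \sum_j grad g x 0 j * v 0 j + L / 2 * sq v.
Proof.
move=> dg L0 gL.
set q := sq v; set d := \sum_j _.
pose phi t := g (x + t *: v) - (t * d + L / 2 * q * t ^+ 2).
pose dphi t := 'D_v g (x + t *: v) - (d + L * q * t).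
have Dphi t : is_derive t (1 : K) phi (dphi t).
  apply: is_deriveB; first exact: derive_along.
  rewrite (_ : L * q * t = L / 2 * q * (2 * t)); last by field.
  exact: is_derive_quad.
have cphi : {within `[0, 1], continuous phi}.
  apply: continuous_subspaceT => t; apply: differentiable_continuous.
  by apply/derivable1_diffP.
have [t tI] := MVT_segment ler01 (fun t _ => Dphi t) cphi.
rewrite /phi scale1r scale0r !addr0 expr0n mulr0 mul0r !subr0 addr0 expr1n !mulr1 mul1r.
have : dphi t <= 0.
  have t0 : 0 <= t by move: tI; rewrite in_itv => /andP[].
  have := gL (x + t *: v) x; rewrite addrAC subrr add0r => /ler_sqr_enorm.
  rewrite wsqZ mulrA -exprMn => /(dot_le (mulr_ge0 L0 t0)).
  under eq_bigr do rewrite mxBE mulrBl.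
  rewrite sumrB /dphi derive_grad// -/d -/q; lra.
lra.
Qed.

Lemma class_C_diff (K : realType) (V : normedModType K) s (g : V -> K) :
  class_C s.+1 g -> forall x, differentiable g x.
Proof. by case. Qed.

Lemma ler_Lmax (K : realType) n (L : 'I_n -> K) i : L i <= Lmax L.
Proof. exact: le_bigmax. Qed.

Lemma gradFc_lip (K : realType) n m (f : 'I_n -> 'rV[K]_m -> K) (L : 'I_n -> K)
    (X Y : 'M[K]_(n, m)) :
  (forall k x, differentiable (f k) x) ->
  (forall i, elipschitz (L i) (grad (f i))) ->
  sq (grad (Fc f) X - grad (Fc f) Y) <= Lmax L ^+ 2 * sq (X - Y).
Proof.
move=> df fL; rewrite sqE (sqE (X - Y)) mulr_sumr; apply: ler_sum => i _.
have h : enorm (grad (f i) (row i X) - grad (f i) (row i Y)) <=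
    Lmax L * enorm (row i X - row i Y).
  apply: le_trans (fL _ _ _) _; apply: ler_wpM2r; first exact: enorm_ge0.
  exact: ler_Lmax.
have := ler_sqr_enorm h; rewrite !sqE !big_ord1 => h1.
apply: le_trans (_ : _ <= _) (le_trans h1 _); rewrite ?le_eqVlt.
  by apply/orP/or_introl; apply/eqP/eq_bigr => j _; rewrite !mxBE !grad_Fc.
by apply/orP/or_introl; apply/eqP; congr (_ * _); apply: eq_bigr => j _; rewrite !mxE.
Qed.

Lemma ones_gradFc (K : realType) n m (f : 'I_n -> 'rV[K]_m -> K) (X : 'M[K]_(n, m)) :
  (forall k x, differentiable (f k) x) ->
  (ones K n)^T *m grad (Fc f) X = \sum_i grad (f i) (row i X).
Proof.
move=> df; apply/rowP => j; rewrite mul_onesE summxE.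
by apply: eq_bigr => i _; rewrite grad_Fc.
Qed.

(** Outside a ball g is positive, and on the ball it attains its minimum. *)
Lemma coercive_bounded_below (K : realType) m (g : 'rV[K]_m -> K) :
  continuous g -> coercive g -> exists B, forall x, B <= g x.
Proof.
move=> cg /(_ 0)[B gB].
have [w _ wmin] : exists2 w : 'rV[K]_m, w \in [set w : 'rV[K]_m | sq w <= B ^+ 2] &
   forall t, t \in [set w : 'rV[K]_m | sq w <= B ^+ 2] -> g w <= g t.
  apply: EVT_min_rV.
  - by exists 0; rewrite /= wsq0 sqr_ge0.
  - exact: compact_eball.
  - exact: continuous_subspaceT.
exists (Num.min 0 (g w)) => x; rewrite ge_min.
have [xB|xB] := lerP (sq x) (B ^+ 2); first by rewrite wmin ?orbT// inE.
rewrite ltW// gB//; case: (lerP 0 B) => B0.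
  by rewrite -(@ltr_pXn2r _ 2)// ?nnegrE ?enorm_ge0// enorm_sq.
by apply: lt_le_trans B0 _; exact: enorm_ge0.
Qed.

(** * One step of the iteration *)

Lemma vmin_le (K : realType) n (v : 'cV[K]_n) i : vmin v <= v i 0.
Proof. exact: bigmin_le. Qed.

Lemma vmin_le1 (K : realType) n (v : 'cV[K]_n) : vmin v <= 1.
Proof. exact: bigmin_le_id. Qed.

Lemma le_vmax (K : realType) n (v : 'cV[K]_n) i : v i 0 <= vmax v.
Proof. exact: (le_bigmax _ (fun i => v i 0) i). Qed.

Lemma stochastic_le1 (K : realType) n (v : 'cV[K]_n) i :
  stochastic_vec v -> v i 0 <= 1.
Proof.
by move=> [v0 <-]; rewrite (bigD1 i)//= lerDl sumr_ge0// => k _.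
Qed.

Lemma vmax_le1 (K : realType) n (v : 'cV[K]_n) : stochastic_vec v -> vmax v <= 1.
Proof. by move=> hv; apply: bigmax_le => // i _; exact: stochastic_le1. Qed.

Lemma vmax_ge0 (K : realType) n (v : 'cV[K]_n) : 0 <= vmax v.
Proof. exact: bigmax_ge_id. Qed.

Lemma zetaE (K : realType) n (r c : 'cV[K]_n) : zeta r c = \sum_i r i 0 * c i 0.
Proof. by rewrite /zeta mxE; apply: eq_bigr => i _; rewrite mxE. Qed.

Lemma zeta_le1 (K : realType) n (r c : 'cV[K]_n) :
  stochastic_vec r -> stochastic_vec c -> zeta r c <= 1.
Proof.
move=> hr hc; rewrite zetaE -[leRHS]hr.2; apply: ler_sum => i _.
by rewrite ler_piMr ?hr.1// stochastic_le1.
Qed.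

Lemma vmin_le_zeta (K : realType) n (r c : 'cV[K]_n) :
  stochastic_vec c -> vmin r <= zeta r c.
Proof.
move=> hc; rewrite zetaE -[leLHS]mulr1 -hc.2 mulr_sumr; apply: ler_sum => i _.
by rewrite ler_wpM2r ?hc.1// vmin_le.
Qed.

Lemma sq_le_wsq (K : realType) p q (a : K) (w : 'I_p -> K) (A : 'M[K]_(p, q)) :
  (forall i, 1 <= a * w i) -> sq A <= a * wsq w A.
Proof. by move=> h; rewrite -wsqM; exact: ler_wsq. Qed.

Lemma sq_le_vmin (K : realType) n m (r : 'cV[K]_n) (A : 'M[K]_(n, m)) :
  0 < vmin r -> sq A <= (vmin r)^-1 * wsq (fun i => r i 0) A.
Proof.
by move=> r0; apply: sq_le_wsq => i; rewrite ler_pdivlMl// mulr1 vmin_le.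
Qed.

Lemma sq_le_vmax (K : realType) n m (c : 'cV[K]_n) (A : 'M[K]_(n, m)) :
  (forall i, 0 < c i 0) -> sq A <= vmax c * wsq (fun i => (c i 0)^-1) A.
Proof.
by move=> c0; apply: sq_le_wsq => i; rewrite ler_pdivlMr// mul1r le_vmax.
Qed.

(** Passing from the c-norm to the r-norm costs r_i c_i in row i. *)
Lemma wsqR_le_wsqC (K : realType) n m (r c : 'cV[K]_n) (A : 'M[K]_(n, m)) :
  (forall i, 0 < c i 0) ->
  wsq (fun i => r i 0) A <= vmax r * vmax c * wsq (fun i => (c i 0)^-1) A.
Proof.
move=> c0; rewrite -wsqM; apply: ler_wsq => i; rewrite ler_pdivlMr//.
apply: (@le_trans _ _ (vmax r * c i 0)).
  by rewrite ler_wpM2r ?le_vmax// ltW.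
by rewrite ler_wpM2l ?le_vmax ?vmax_ge0.
Qed.

Lemma wsqC_le_sq (K : realType) n m (c : 'cV[K]_n) (A : 'M[K]_(n, m)) :
  0 < vmin c -> (forall i, 0 < c i 0) ->
  wsq (fun i => (c i 0)^-1) A <= (vmin c)^-1 * sq A.
Proof.
move=> cm c0; rewrite -wsqM; apply: ler_wsq => i.
by rewrite mulr1 lef_pV2 ?posrE// vmin_le.
Qed.

Lemma sq_mean_le (K : realType) n m (r : 'cV[K]_n) (A : 'M[K]_(n, m)) :
  stochastic_vec r -> sq (r^T *m A) <= sq A.
Proof.
move=> hr; rewrite !sqE big_ord1 exchange_big/=; apply: ler_sum => j _.
have -> : (r^T *m A) 0 j = \sum_i r i 0 * A i j.
  by rewrite mxE; apply: eq_bigr => i _; rewrite mxE.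
apply: le_trans (jensen_sq _ hr.1 hr.2) _; apply: ler_sum => i _.
by rewrite ler_piMl ?sqr_ge0 ?stochastic_le1.
Qed.

Lemma wsq_outer (K : realType) n m (w : 'I_n -> K) (c : 'cV[K]_n) (g : 'rV[K]_m) :
  wsq w (c *m g) = (\sum_i w i * c i 0 ^+ 2) * sq g.
Proof.
rewrite mulr_suml; apply: eq_bigr => i _; rewrite -mulrA; congr (_ * _).
rewrite sqE big_ord1 mulr_sumr; apply: eq_bigr => j _.
by rewrite mxE big_ord1 exprMn.
Qed.

(** The disagreement of c g has the r-variance of c as its coefficient, which is at
    most zeta - zeta^2 <= 1/4 since the entries of c lie in [0, 1]. *)
Lemma wsq_subJR_outer (K : realType) n m (r c : 'cV[K]_n) (g : 'rV[K]_m) :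
  stochastic_vec r -> stochastic_vec c ->
  wsq (fun i => r i 0) ((1%:M - JR r) *m (c *m g)) <= 4^-1 * sq g.
Proof.
move=> hr hc; rewrite wsq_subJR ?hr.2// wsq_outer mulmxA.
have -> : r^T *m c *m g = zeta r c *: g.
  by rewrite [r^T *m c]mx11_scalar mul_scalar_mx.
rewrite wsqZ -mulrBl ler_wpM2r ?sq_ge0//.
have : \sum_i r i 0 * c i 0 ^+ 2 <= zeta r c.
  rewrite zetaE; apply: ler_sum => i _; rewrite ler_wpM2l ?hr.1//.
  by rewrite expr2 ler_piMl ?hc.1 ?stochastic_le1.
have := sqr_ge0 (zeta r c - 2^-1); rewrite sqrrB; lra.
Qed.

Lemma sq_outer_le (K : realType) n m (c : 'cV[K]_n) (g : 'rV[K]_m) :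
  stochastic_vec c -> sq (c *m g) <= sq g.
Proof.
move=> hc; rewrite wsq_outer ler_piMl ?sq_ge0// -[leRHS]hc.2; apply: ler_sum => i _.
by rewrite mul1r expr2 ler_piMl ?hc.1 ?stochastic_le1.
Qed.

(** The case e = rho = 0 is a limit of the generic one: the contracted term
    vanishes and no splitting is needed, in agreement with 0^-1 = 0. *)
Lemma wsq_contract_split (K : realType) p q (w : 'I_p -> K) (e rho S : K)
    (A B : 'M[K]_(p, q)) :
  (forall i, 0 < w i) -> 0 < e \/ e = 0 /\ rho = 0 -> wsq w A <= rho ^+ 2 * S ->
  wsq w (A + B) <= rho ^+ 2 * (1 + e) * S + (1 + e^-1) * wsq w B.
Proof.
move=> w0 [e0|[-> ->]] hA.
  apply: le_trans (wsq_young _ _ (fun i => ltW (w0 i)) e0) _.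
  rewrite lerD2r mulrAC (mulrC (1 + e)) ler_wpM2r// addr_ge0// ltW//.
have -> : A = 0 by apply: (wsq_eq0 w0); move: hA; rewrite expr0n mul0r.
by rewrite add0r expr0n !mul0r add0r invr0 addr0 mul1r.
Qed.

Lemma JR_idem (K : realType) n (r : 'cV[K]_n) : \sum_i r i 0 = 1 ->
  JR r *m JR r = JR r.
Proof.
move=> r1; rewrite /JR mulmxA -(mulmxA _ r^T).
have -> : r^T *m ones K n = 1.
  apply/matrixP => i j; rewrite !ord1 mxE -[RHS]mulr1n mxE eqxx mulr1n -[RHS]r1.
  by apply: eq_bigr => k _; rewrite /ones !mxE mulr1.
by rewrite mulmx1.
Qed.

Lemma JC_idem (K : realType) n (c : 'cV[K]_n) : \sum_i c i 0 = 1 ->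
  JC c *m JC c = JC c.
Proof.
move=> c1; rewrite /JC mulmxA -(mulmxA c).
have -> : (ones K n)^T *m c = 1.
  apply/matrixP => i j; rewrite !ord1 mul_onesE -[RHS]mulr1n mxE eqxx mulr1n.
  exact: c1.
by rewrite mulmx1.
Qed.

(** The disagreement evolves by itself: neither R nor the projection moves
    consensual vectors out of the consensus line, and r is a left fixed vector. *)
Lemma consensus_split (K : realType) n (R : 'M[K]_n) (r : 'cV[K]_n) :
  row_stochastic R -> r^T *m R = r^T -> \sum_i r i 0 = 1 ->
  (1%:M - JR r) *m R = (R - JR r) *m (1%:M - JR r) /\
  R *m (1%:M - JR r) = (R - JR r) *m (1%:M - JR r).
Proof.
move=> Rs rR r1; have [e1 e2] := subJR_mul Rs rR r1.
have h : R - JR r = (R - JR r) *m (1%:M - JR r).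
  have RJ : R *m JR r = JR r by rewrite /JR mulmxA Rs.2.
  by rewrite mulmxBr mulmx1 mulmxBl RJ JR_idem// subrr subr0.
by rewrite -h -e2 -e1.
Qed.

Lemma tracking_split (K : realType) n (C : 'M[K]_n) (c : 'cV[K]_n) :
  col_stochastic C -> C *m c = c -> \sum_i c i 0 = 1 ->
  (1%:M - JC c) *m C = (C - JC c) *m (1%:M - JC c).
Proof.
move=> Cs Cc c1.
have CJ : C *m JC c = JC c by rewrite /JC mulmxA Cc.
have JCC : JC c *m C = JC c by rewrite /JC -mulmxA Cs.2.
by rewrite !mulmxBr !mulmxBl !mul1mx !mulmx1 CJ JCC JC_idem// subrr subr0.
Qed.

Lemma subJC_decomp (K : realType) n m (c : 'cV[K]_n) (y : 'M[K]_(n, m)) :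
  y = (1%:M - JC c) *m y + c *m ((ones K n)^T *m y).
Proof. by rewrite mulmxBl mul1mx /JC -mulmxA subrK. Qed.

Lemma subJR_decomp (K : realType) n m (r : 'cV[K]_n) (x : 'M[K]_(n, m)) :
  (1%:M - JR r) *m x = x - ones K n *m (r^T *m x).
Proof. by rewrite mulmxBl mul1mx /JR -mulmxA. Qed.

(** The tracker perturbs the disagreement of x through its own disagreement, and
    through its mean spread along c, which is not consensual unless c is. *)
Lemma consensus_step (K : realType) n m (R : 'M[K]_n) (r c : 'cV[K]_n)
    (x y : 'M[K]_(n, m)) (alpha e : K) :
  row_stochastic R -> r^T *m R = r^T -> stochastic_vec r -> stochastic_vec c ->
  (forall i, 0 < r i 0) -> (forall i, 0 < c i 0) ->
  0 < e \/ e = 0 /\ rhoR R r = 0 ->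
  wsq (fun i => r i 0) ((1%:M - JR r) *m (R *m x - alpha *: y)) <=
  rhoR R r ^+ 2 * (1 + e) * wsq (fun i => r i 0) ((1%:M - JR r) *m x) +
  (1 + e^-1) * (alpha ^+ 2 *
    (2 * (vmax r * vmax c) * wsq (fun i => (c i 0)^-1) ((1%:M - JC c) *m y) +
     2^-1 * sq ((ones K n)^T *m y))).
Proof.
move=> Rs rR hr hc r0 c0 he.
have r0' i : 0 <= r i 0 by exact: ltW.
rewrite mulmxBr mulmxA (consensus_split Rs rR hr.2).1 -mulmxA -scalemxAr.
have := wsq_contract_split (- (alpha *: ((1%:M - JR r) *m y))) r0 he
  (rhoR_contraction R ((1%:M - JR r) *m x) r0).
rewrite wsqN wsqZ => h; apply: le_trans h _; rewrite lerD2l ler_wpM2l//.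
  by rewrite addr_ge0// invr_ge0; case: he => [/ltW//|[->]].
rewrite ler_wpM2l ?sqr_ge0// {1}[y](subJC_decomp c) mulmxDr.
apply: le_trans (wsq_young _ _ r0' ltr01) _; rewrite invr1 -!mulr2n.
set yp := (1%:M - JC c) *m y; set g := (ones K n)^T *m y.
have h1 : wsq (fun i => r i 0) ((1%:M - JR r) *m yp) <=
    vmax r * vmax c * wsq (fun i => (c i 0)^-1) yp.
  apply: le_trans (wsqR_le_wsqC _ _ c0).
  by rewrite wsq_subJR ?hr.2// gerBl sq_ge0.
have h2 := wsq_subJR_outer g hr hc.
lra.
Qed.

(** Only the disagreement of x moves under R - 1, by at most a factor 2 in r-norm.
    The splitting 3/2, 3 gives (3/2) 4 = 6 for this part and 3 * 2 = 6 for each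
    half of the tracker, so that all three parts enter with the same constant. *)
Lemma increment_le (K : realType) n m (R : 'M[K]_n) (r c : 'cV[K]_n)
    (x y : 'M[K]_(n, m)) (alpha : K) :
  row_stochastic R -> r^T *m R = r^T -> stochastic_vec r -> stochastic_vec c ->
  0 < vmin r -> (forall i, 0 < r i 0) -> (forall i, 0 < c i 0) -> rhoR R r <= 1 ->
  sq (R *m x - alpha *: y - x) <=
  6 * (vmin r)^-1 * wsq (fun i => r i 0) ((1%:M - JR r) *m x) +
  6 * alpha ^+ 2 *
    (vmax c * wsq (fun i => (c i 0)^-1) ((1%:M - JC c) *m y) +
     sq ((ones K n)^T *m y)).
Proof.
move=> Rs rR hr hc rm r0 c0 rho1.
have r0' i : 0 <= r i 0 by exact: ltW.
set xp := (1%:M - JR r) *m x; set yp := (1%:M - JC c) *m y.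
set g := (ones K n)^T *m y.
have -> : R *m x - alpha *: y - x = (R *m xp - xp) + - (alpha *: y).
  rewrite /xp mulmxBl mul1mx mulmxBr /JR !mulmxA Rs.2 opprB addrA subrK.
  by rewrite addrAC.
(* e = 1/2 in Young's inequality gives the constants 3/2 and 3 *)
have two0 : (0 : K) < 2^-1 by rewrite invr_gt0.
have y1 := wsq_young (R *m xp - xp) (- (alpha *: y)) (fun=> ler01) two0.
rewrite wsqN wsqZ invrK in y1; apply: le_trans y1 _.
have hxR : wsq (fun i => r i 0) (R *m xp - xp) <= 4 * wsq (fun i => r i 0) xp.
  apply: le_trans (wsq_young _ _ r0' ltr01) _; rewrite wsqN invr1.
  have : wsq (fun i => r i 0) (R *m xp) <= wsq (fun i => r i 0) xp.
    rewrite {1}/xp mulmxA (consensus_split Rs rR hr.2).2 -mulmxA -/xp.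
    apply: le_trans (rhoR_contraction _ _ r0) _; rewrite ler_piMl ?wsq_ge0//.
    by rewrite expr_le1// opnorm2_ge0.
  lra.
have hx : sq (R *m xp - xp) <= 4 * ((vmin r)^-1 * wsq (fun i => r i 0) xp).
  apply: le_trans (sq_le_vmin _ rm) _; rewrite mulrCA ler_wpM2l//.
  by rewrite invr_ge0 ltW.
have hy : sq y <= 2 * (vmax c * wsq (fun i => (c i 0)^-1) yp) + 2 * sq g.
  rewrite {1}[y](subJC_decomp c).
  apply: le_trans (wsq_young _ _ (fun=> ler01) ltr01) _; rewrite invr1.
  have := sq_le_vmax yp c0; have := sq_outer_le g hc; lra.
have := ler_wpM2l (sqr_ge0 alpha) hy; lra.
Qed.

Lemma tracking_step (K : realType) n m (C : 'M[K]_n) (c : 'cV[K]_n)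
    (y D : 'M[K]_(n, m)) (e : K) :
  col_stochastic C -> C *m c = c -> stochastic_vec c -> 0 < vmin c ->
  (forall i, 0 < c i 0) -> 0 < e \/ e = 0 /\ rhoC C c = 0 ->
  wsq (fun i => (c i 0)^-1) ((1%:M - JC c) *m (C *m y + D)) <=
  rhoC C c ^+ 2 * (1 + e) * wsq (fun i => (c i 0)^-1) ((1%:M - JC c) *m y) +
  (1 + e^-1) * ((vmin c)^-1 * sq D).
Proof.
move=> Cs Cfix hc cm c0 he.
have ci0 i : 0 < (c i 0)^-1 by rewrite invr_gt0.
rewrite mulmxDr mulmxA (tracking_split Cs Cfix hc.2) -mulmxA.
have h := wsq_contract_split ((1%:M - JC c) *m D) ci0 he
  (rhoC_contraction C ((1%:M - JC c) *m y) c0).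
apply: le_trans h _; rewrite lerD2l ler_wpM2l//.
  by rewrite addr_ge0// invr_ge0; case: he => [/ltW//|[->]].
exact: le_trans (wsq_subJC_le _ hc.2 c0) (wsqC_le_sq _ cm c0).
Qed.

(** The difference of the two sides is a sum of four squares: the three Young
    splittings of the cross terms g s, g e and e s, and that of the quadratic
    term. *)
Lemma objective_scalar (K : realType) (alpha z eps1 LF g e s : K) :
  0 < alpha -> 0 < z -> 0 < eps1 -> 0 <= LF ->
  (g + e) * - (alpha * (z * g + s)) + LF / 2 * (alpha * (z * g + s)) ^+ 2 <=
  - ((z - eps1 * z / 2 - eps1 / 2) * alpha - LF * z ^+ 2 * alpha ^+ 2) * g ^+ 2 +
  alpha / 2 * (1 + z / eps1) * e ^+ 2 +
  (alpha / 2 * (1 + eps1^-1) + LF * alpha ^+ 2) * s ^+ 2.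
Proof.
move=> a0 z0 e10 LF0; rewrite -subr_ge0.
rewrite (_ : _ - _ = LF / 2 * alpha ^+ 2 * (z * g - s) ^+ 2 +
  alpha / 2 * (e + s) ^+ 2 +
  alpha / 2 * eps1^-1 * ((eps1 * g + s) ^+ 2) +
  alpha * z / 2 * eps1^-1 * ((eps1 * g + e) ^+ 2)); last first.
  by field; rewrite gt_eqF.
by rewrite !addr_ge0// mulr_ge0 ?sqr_ge0// !mulr_ge0 ?invr_ge0 ?sqr_ge0// ltW.
Qed.

(** The mean iterate performs a gradient step for F of length alpha z, with two
    errors: the gradients are evaluated away from the mean (e), and the trackers
    disagree (s). *)
Lemma objective_step (K : realType) m (F : 'rV[K]_m -> K)
    (xb g e s : 'rV[K]_m) (alpha z eps1 LF : K) :
  (forall x, differentiable F x) -> elipschitz LF (grad F) ->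
  0 < alpha -> 0 < z -> 0 < eps1 -> 0 <= LF -> grad F xb = g + e ->
  F (xb - alpha *: (z *: g + s)) <= F xb
  - ((z - eps1 * z / 2 - eps1 / 2) * alpha - LF * z ^+ 2 * alpha ^+ 2) * sq g +
  alpha / 2 * (1 + z / eps1) * sq e +
  (alpha / 2 * (1 + eps1^-1) + LF * alpha ^+ 2) * sq s.
Proof.
move=> dF hLF a0 z0 e10 LF0 gE.
apply: le_trans (descent_lemma xb _ dF LF0 hLF) _.
rewrite gE -!addrA lerD2l !addrA wsqN wsqZ !sqE !big_ord1 -mulNr !mulr_sumr.
rewrite -!big_split/=; apply: ler_sum => j _.
apply: le_trans (objective_scalar (g 0 j) (e 0 j) (s 0 j) a0 z0 e10 LF0).
by rewrite !mxE exprMn.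
Qed.

(** Both terms are sums of the rows of the gradient of F_c, at 1 (x) xbar and at x;
    summing n rows costs the factor n. *)
Lemma mean_gradient_error (K : realType) n m (f : 'I_n -> 'rV[K]_m -> K)
    (L : 'I_n -> K) (r : 'cV[K]_n) (x : 'M[K]_(n, m)) :
  (forall k x, differentiable (f k) x) ->
  (forall i, elipschitz (L i) (grad (f i))) -> 0 < vmin r ->
  sq (grad (Fsum f) (r^T *m x) - (ones K n)^T *m grad (Fc f) x) <=
  n%:R * Lmax L ^+ 2 / vmin r * wsq (fun i => r i 0) ((1%:M - JR r) *m x).
Proof.
move=> df fL rm.
have -> : grad (Fsum f) (r^T *m x) =
    (ones K n)^T *m grad (Fc f) (ones K n *m (r^T *m x)).
  rewrite ones_gradFc// grad_Fsum//; apply: eq_bigr => i _; congr (grad _ _).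
  by apply/rowP => j; rewrite [RHS]mxE ones_mulE.
rewrite -mulmxBr; apply: le_trans (sq_mul_ones _) _.
rewrite -mulrA -mulrA ler_wpM2l//; apply: le_trans (gradFc_lip _ _ df fL) _.
rewrite ler_wpM2l ?sqr_ge0// -wsqN opprB -subJR_decomp.
exact: sq_le_vmin.
Qed.

(** The column sums of y are conserved by C and follow the increments of the
    gradients; the initial condition starts the invariant, as the columns of
    C - 1 have zero sum. *)
Lemma ybar_tracking (K : realType) n m (f : 'I_n -> 'rV[K]_m -> K) (R C : 'M[K]_n)
    (alpha : K) (x y : nat -> 'M[K]_(n, m)) :
  col_stochastic C -> dogt f R C alpha x y ->
  forall nu, (ones K n)^T *m y nu = (ones K n)^T *m grad (Fc f) (x nu).
Proof.
move=> [_ C1] [[z y0] _ yS]; elim=> [|nu IH].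
  by rewrite y0 mulmxDr mulmxA mulmxBr mulmx1 C1 subrr mul0mx addr0.
by rewrite yS !mulmxDr mulmxN mulmxA C1 IH addrAC addrC subrr addr0.
Qed.

(** * Decrease of the Lyapunov function *)

Lemma K_2R_sq (K : realType) n (r : 'cV[K]_n) : 0 < vmin r -> K_2R r ^+ 2 = (vmin r)^-1.
Proof. by move=> r0; rewrite /K_2R exprVn sqr_sqrtr// ltW. Qed.

Lemma K_2C_sq (K : realType) n (c : 'cV[K]_n) : K_2C c ^+ 2 = vmax c.
Proof. by rewrite /K_2C sqr_sqrtr// vmax_ge0. Qed.

Lemma K_C2_sq (K : realType) n (c : 'cV[K]_n) : 0 < vmin c -> K_C2 c ^+ 2 = (vmin c)^-1.
Proof. by move=> c0; rewrite /K_C2 exprVn sqr_sqrtr// ltW. Qed.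

Lemma K_RC_sq (K : realType) n (r c : 'cV[K]_n) : K_RC r c ^+ 2 = vmax r * vmax c.
Proof. by rewrite /K_RC sqr_sqrtr// mulr_ge0 ?vmax_ge0. Qed.

(** Negativity of the coefficients of X, Y and G in one step of V, in this order.
    Compared with the constants of rhotR, rhotC and Gammat, the weight 2 of the
    consensus error doubles the contraction gap of x and K2, and the increment of x
    enters with the constant 6 in place of 3. *)
Definition admissible (K : realType) n (R C : 'M[K]_n) (r c : 'cV[K]_n)
    (Lc LF alpha ex ey e1 kappa : K) : Prop :=
  [/\ [/\ 0 < alpha, 0 < kappa & 0 < e1],
      (0 < ex \/ ex = 0 /\ rhoR R r = 0) /\ (0 < ey \/ ey = 0 /\ rhoC C c = 0),
      alpha * n%:R * Lc ^+ 2 * K_2R r ^+ 2 / 2 * (1 + zeta r c / e1)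
        + 2 * (kappa * K6 r c Lc * (1 + ey^-1))
        < 2 * (1 - rhoR R r ^+ 2 * (1 + ex)),
      alpha / 2 * K_2C c ^+ 2 * (1 + e1^-1)
        + alpha ^+ 2 * (LF * K_2C c ^+ 2 + 2 * K2 r c ex
                        + 2 * kappa * K4 c Lc * (1 + ey^-1))
        < kappa * (1 - rhoC C c ^+ 2 * (1 + ey))
    & alpha * (LF * zeta r c ^+ 2 + (1 + ex^-1)
               + 2 * kappa * K5 c Lc * (1 + ey^-1))
        < zeta r c - e1 * zeta r c / 2 - e1 / 2].

Definition cons_err (K : realType) n m (r : 'cV[K]_n) (x : 'M[K]_(n, m)) : K :=
  wsq (fun i => r i 0) ((1%:M - JR r) *m x).
Definition track_err (K : realType) n m (c : 'cV[K]_n) (y : 'M[K]_(n, m)) : K :=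
  wsq (fun i => (c i 0)^-1) ((1%:M - JC c) *m y).
Definition mean_sq (K : realType) n m (y : 'M[K]_(n, m)) : K :=
  sq ((ones K n)^T *m y).

(** The step is a sum of the one-step estimates with the weights 1, 2 and kappa;
    what remains is linear in X, Y and G, and delta is the smallest of the three
    margins. *)
Lemma lyapunov_step (K : realType) (n m : nat)
    (f : 'I_n -> 'rV[K]_m -> K) (L : 'I_n -> K) (LF : K) (R C : 'M[K]_n)
    (r c : 'cV[K]_n) (alpha ex ey e1 kappa : K) (x y : nat -> 'M[K]_(n, m)) :
  (forall k x, differentiable (f k) x) ->
  (forall i, elipschitz (L i) (grad (f i))) ->
  elipschitz LF (grad (Fsum f)) -> 0 <= LF ->
  row_stochastic R -> col_stochastic C -> r^T *m R = r^T -> C *m c = c ->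
  stochastic_vec r -> stochastic_vec c -> 0 < vmin r -> 0 < vmin c ->
  rhoR R r <= 1 ->
  admissible R C r c (Lmax L) LF alpha ex ey e1 kappa -> dogt f R C alpha x y ->
  let V nu := Fsum f (r^T *m x nu) + 2 * cons_err r (x nu)
              + kappa * track_err c (y nu) in
  exists2 delta, 0 < delta & forall nu,
    V nu.+1 <= V nu - delta * (cons_err r (x nu) + track_err c (y nu)
                               + mean_sq (y nu)).
Proof.
move=> df fL hLF LF0 Rs Cs rR Cfix hr hc rm cm rho1 hadm hxy V.
have r0 i : 0 < r i 0 by apply: lt_le_trans rm (vmin_le _ _).
have c0 i : 0 < c i 0 by apply: lt_le_trans cm (vmin_le _ _).
have [[a0 k0 e10] [hex hey] cX cY cG] := hadm.
have dF z : differentiable (Fsum f) z.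
  rewrite (_ : Fsum f = \sum_i f i); first exact: differentiable_sum.
  by apply/funext => t; rewrite fct_sumE.
have z0 : 0 < zeta r c by apply: lt_le_trans rm (vmin_le_zeta _ hc).
pose dX := 2 * (1 - rhoR R r ^+ 2 * (1 + ex)) -
  (alpha * n%:R * Lmax L ^+ 2 * K_2R r ^+ 2 / 2 * (1 + zeta r c / e1)
        + 2 * (kappa * K6 r c (Lmax L) * (1 + ey^-1))).
pose dY := kappa * (1 - rhoC C c ^+ 2 * (1 + ey)) -
 (alpha / 2 * K_2C c ^+ 2 * (1 + e1^-1)
        + alpha ^+ 2 * (LF * K_2C c ^+ 2 + 2 * K2 r c ex
                        + 2 * kappa * K4 c (Lmax L) * (1 + ey^-1))).
pose dG := alpha * (zeta r c - e1 * zeta r c / 2 - e1 / 2 - 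
 alpha * (LF * zeta r c ^+ 2 + (1 + ex^-1)
               + 2 * kappa * K5 c (Lmax L) * (1 + ey^-1))).
have dX0 : 0 < dX by rewrite subr_gt0.
have dY0 : 0 < dY by rewrite subr_gt0.
have dG0 : 0 < dG by rewrite mulr_gt0// subr_gt0.
exists (Num.min dX (Num.min dY dG)); first by rewrite !lt_min dX0 dY0 dG0.
move=> nu; set delta := Num.min _ _.
set X := cons_err r (x nu); set Y := track_err c (y nu); set G := mean_sq (y nu).
have X0 : 0 <= X by apply: wsq_ge0 => i; exact: ltW.
have Y0 : 0 <= Y by apply: wsq_ge0 => i; rewrite invr_ge0 ltW.
have G0 : 0 <= G by exact: sq_ge0.
have deltaX : delta * X <= dX * X by rewrite ler_wpM2r// ge_min lexx.
have deltaY : delta * Y <= dY * Y by rewrite ler_wpM2r// !ge_min lexx orbT.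
have deltaG : delta * G <= dG * G by rewrite ler_wpM2r// !ge_min lexx !orbT.
suff : V nu.+1 <= V nu - (dX * X + dY * Y + dG * G) by move=> h; lra.
have [_ xS yS] := hxy.
have ytr := ybar_tracking Cs hxy nu.
set g := (ones K n)^T *m y nu in ytr.
pose e := grad (Fsum f) (r^T *m x nu) - g.
pose s := r^T *m ((1%:M - JC c) *m y nu).
have xbS : r^T *m x nu.+1 = r^T *m x nu - alpha *: (zeta r c *: g + s).
  rewrite xS mulmxBr mulmxA rR -scalemxAr {1}[y nu](subJC_decomp c) mulmxDr -/s.
  rewrite [r^T *m (c *m _)]mulmxA [r^T *m c]mx11_scalar mul_scalar_mx -/(zeta r c).
  by rewrite [s + _]addrC.
have gE : grad (Fsum f) (r^T *m x nu) = g + e by rewrite /e addrC subrK.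
have stepF := objective_step s dF hLF a0 z0 e10 LF0 gE.
rewrite -xbS in stepF.
have eX : sq e <= n%:R * Lmax L ^+ 2 / vmin r * X.
  by rewrite /e ytr; exact: mean_gradient_error.
have sY : sq s <= vmax c * Y.
  exact: le_trans (sq_mean_le _ hr) (sq_le_vmax _ c0).
have stepX := consensus_step (x nu) (y nu) alpha Rs rR hr hc r0 c0 hex.
rewrite -xS -/(cons_err r (x nu.+1)) -/(cons_err r (x nu)) in stepX.
rewrite -/(track_err c (y nu)) -/(mean_sq (y nu)) -/X -/Y -/G in stepX.
have stepY := tracking_step (y nu) (grad (Fc f) (x nu.+1) - grad (Fc f) (x nu))
  Cs Cfix hc cm c0 hey.
rewrite addrA -yS -/(track_err c (y nu.+1)) -/(track_err c (y nu)) -/Y in stepY.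
have inc := increment_le (x nu) (y nu) alpha Rs rR hr hc rm r0 c0 rho1.
rewrite -xS -/(cons_err r (x nu)) -/(track_err c (y nu)) in inc.
rewrite -/(mean_sq (y nu)) -/X -/Y -/G in inc.
have DL := gradFc_lip (x nu.+1) (x nu) df fL.
have w0 : 0 <= 1 + ey^-1.
  by rewrite addr_ge0// invr_ge0; case: hey => [/ltW//|[->]].
have {}stepY : kappa * track_err c (y nu.+1) <= kappa * (rhoC C c ^+ 2 * (1 + ey) * Y) +
   kappa * (1 + ey^-1) * ((vmin c)^-1 * (Lmax L ^+ 2 * (6 * (vmin r)^-1 * X + 
        6 * alpha ^+ 2 * (vmax c * Y + G)))).
  rewrite -(mulrA kappa (1 + ey^-1)) -mulrDr ler_wpM2l ?(ltW k0)//.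
  apply: le_trans stepY _.
  rewrite lerD2l ler_wpM2l// ler_wpM2l ?invr_ge0 ?(ltW cm)//.
  by apply: le_trans DL _; rewrite ler_wpM2l ?sqr_ge0.
have ce0 : 0 <= alpha / 2 * (1 + zeta r c / e1).
  by rewrite mulr_ge0 ?divr_ge0 ?addr_ge0 ?divr_ge0// ltW.
have cs0 : 0 <= alpha / 2 * (1 + e1^-1) + LF * alpha ^+ 2.
  by rewrite addr_ge0 ?mulr_ge0 ?sqr_ge0 ?addr_ge0 ?invr_ge0// ltW.
have {}eX := ler_wpM2l ce0 eX.
have {}sY := ler_wpM2l cs0 sY.
rewrite /V -/X -/Y.
rewrite /dX /dY /dG /K6 /K5 /K4 /K2 K_2R_sq// K_2C_sq K_C2_sq// K_RC_sq.
change (sq g) with G in stepF.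
lra.
Qed.

(** * The two step-size rules *)

Lemma stochastic_dim_gt0 (K : realType) n (v : 'cV[K]_n) :
  stochastic_vec v -> (0 < n)%N.
Proof.
case: n v => // v [_]; rewrite big_ord0 => /eqP.
by rewrite eq_sym oner_eq0.
Qed.

Lemma K6E (K : realType) n (r c : 'cV[K]_n) (Lc : K) : 0 < vmin r -> 0 < vmin c ->
  K6 r c Lc = 3 * Lc ^+ 2 / (vmin c * vmin r).
Proof.
move=> r0 c0; rewrite /K6 K_C2_sq// K_2R_sq//; field.
by rewrite !gt_eqF.
Qed.

(** The third bound on alpha forces alpha <= 1/2, because K3 >= 2 and zeta <= 1.
    Hence alpha^2 <= alpha / 2, which pays for the doubled constants in the
    coefficient of Y. In that of X, the first bound on alpha
    and the bound on kappa leave a total below 1 - rhoR^2, and the contraction gap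
    is at least that because 2 rhoR^2 epsx <= 1 - rhoR^2. In that of G, the bound on
    kappa absorbs the factor 1 + 1 / epsy, and K3 covers what remains. *)
Lemma base_admissible (K : realType) n (R C : 'M[K]_n) (r c : 'cV[K]_n)
    (Lc LF alpha ex ey e1 kappa : K) :
  stochastic_vec r -> stochastic_vec c -> 0 < vmin r -> 0 < vmin c -> 0 <= LF ->
  base_step R C r c Lc LF alpha ex ey e1 kappa ->
  admissible R C r c Lc LF alpha ex ey e1 kappa.
Proof.
move=> hr hc rm cm LF0 [[ex0 hex] [ey0 hey] /andP[e10 he1] /andP[k0 hk] [a0 ha1 ha2 ha3]].
have z0 : 0 < zeta r c by apply: lt_le_trans rm (vmin_le_zeta _ hc).
have z1 := zeta_le1 hr hc.
have u0 : 0 < ex^-1 by rewrite invr_gt0.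
have w0 : 0 < ey^-1 by rewrite invr_gt0.
have Lc2 : 0 < Lc ^+ 2.
  rewrite lt_def sqr_ge0 andbT; apply: contraTneq k0 => Lc0.
  by rewrite -leNgt; apply: le_trans hk _; rewrite /K6 Lc0 mulr0 mul0r invr0 mulr0.
have K60 : 0 < K6 r c Lc by rewrite K6E//; apply: divr_gt0; apply: mulr_gt0.
have K50 : 0 <= K5 c Lc.
  by rewrite /K5 mulr_ge0 ?sqr_ge0// mulr_ge0 ?sqr_ge0.
have K40 : 0 <= K4 c Lc.
  by rewrite /K4 mulr_ge0 ?sqr_ge0// mulr_ge0 ?sqr_ge0// mulr_ge0 ?sqr_ge0.
have K20 : 0 <= K2 r c ex.
  by apply: mulr_ge0; [rewrite mulr_ge0 ?sqr_ge0|rewrite addr_ge0// ltW].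
have cM : 0 <= K_2C c ^+ 2 by rewrite sqr_ge0.
have n1 : 1 <= n%:R :> K by rewrite ler1n (stochastic_dim_gt0 hr).
have P0 : 0 <= rhoR R r ^+ 2 by exact: sqr_ge0.
have hk' : kappa * K6 r c Lc * (1 + ey^-1) <= rhoR R r ^+ 2 * ex.
  by rewrite -mulrA -ler_pdivlMr//; apply: mulr_gt0 => //; rewrite addr_gt0.
have hK5 : kappa * K5 c Lc * (1 + ey^-1) <= 2^-1.
  have -> : K5 c Lc = vmin r * K6 r c Lc.
    by rewrite /K5 /K6 K_2R_sq//; field; rewrite gt_eqF.
  rewrite (_ : _ * _ * _ = vmin r * (kappa * K6 r c Lc * (1 + ey^-1))); last by ring.
  apply: (@le_trans _ _ (1 * (kappa * K6 r c Lc * (1 + ey^-1)))).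
    rewrite ler_wpM2r ?vmin_le1//; apply: mulr_ge0; last by rewrite addr_ge0// ltW.
    by rewrite mulr_ge0// ltW.
  lra.
have D3 : 2 * (1 + ex^-1) <= @K3 K n ex.
  by rewrite /K3 ler_wpM2r ?addr_ge0 ?(ltW u0)//; lra.
have LFz0 : 0 <= LF * zeta r c ^+ 2 by rewrite mulr_ge0 ?sqr_ge0.
have kK50 : 0 <= K5 c Lc * kappa by rewrite mulr_ge0 ?(ltW k0).
have h3 : alpha * (LF * zeta r c ^+ 2 + @K3 K n ex + K5 c Lc * kappa) <
    zeta r c - e1 / 2 * (zeta r c + 1).
  by rewrite -ltr_pdivlMr//; lra.
have a12 : alpha <= 2^-1.
  have e1z : 0 <= e1 * zeta r c by rewrite mulr_ge0// ltW.
  have : alpha * 2 <= alpha * (LF * zeta r c ^+ 2 + @K3 K n ex + K5 c Lc * kappa).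
    by rewrite ler_wpM2l ?(ltW a0)//; lra.
  lra.
have KR0 : 0 < K_2R r ^+ 2 by rewrite K_2R_sq// invr_gt0.
split => //.
- by split; left.
- have D1 : 0 < n%:R * Lc ^+ 2 * K_2R r ^+ 2 * (1 + zeta r c / e1).
    apply: mulr_gt0; last by rewrite addr_gt0 ?divr_gt0.
    by apply: mulr_gt0 => //; apply: mulr_gt0 => //; lra.
  move: ha1; rewrite ltr_pdivlMr// => h1; lra.
- have e1i : 0 < e1^-1 by rewrite invr_gt0.
  set D2 := (_ + _ + _) in ha2.
  have kD2 : kappa * D2 = K_2C c ^+ 2 / 2 * (1 + e1^-1 + 2 * LF) + K2 r c ex
    + kappa * (K4 c Lc * (1 + ey^-1)) by rewrite /D2; field; rewrite !gt_eqF.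
  have W0 : 0 <= kappa * (K4 c Lc * (1 + ey^-1)).
    by rewrite mulr_ge0 ?(ltW k0)// mulr_ge0// addr_ge0// ltW.
  have LC0 : 0 <= LF * K_2C c ^+ 2 by rewrite mulr_ge0.
  have D20 : 0 < kappa * D2.
    rewrite kD2; apply: ltr_wpDr => //.
    rewrite K_2C_sq; apply: ltr_pwDl.
      rewrite !mulr_gt0 ?invr_gt0//; last by lra.
      by apply: lt_le_trans (le_vmax c (Ordinal (stochastic_dim_gt0 hr)));
         apply: lt_le_trans cm (vmin_le _ _).
    exact: K20.
  have {}D20 : 0 < D2 by rewrite -(pmulr_rgt0 _ k0).
  move: ha2; rewrite ltr_pdivlMr// -(ltr_pM2l k0) mulrCA kD2 => h2.
  have a2 : alpha ^+ 2 * (2 * (LF * K_2C c ^+ 2 + K2 r c ex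
      + kappa * (K4 c Lc * (1 + ey^-1)))) <=
      alpha * (LF * K_2C c ^+ 2 + K2 r c ex + kappa * (K4 c Lc * (1 + ey^-1))).
    rewrite mulrA ler_wpM2r ?addr_ge0// expr2 -mulrA ler_piMr ?(ltW a0)//; lra.
  have a2L : 0 <= alpha ^+ 2 * (LF * K_2C c ^+ 2) by rewrite mulr_ge0 ?sqr_ge0.
  lra.
- apply: le_lt_trans (lt_le_trans h3 _); last by lra.
  rewrite ler_wpM2l ?(ltW a0)//; lra.
Qed.

(** The choice e = (1 - rho^2) / (k rho^2) degenerates to 0 together with its
    inverse when rho = 0; these consequences hold in both cases. *)
Lemma eps_choice (K : realType) (rho e k : K) : 0 <= rho -> rho < 1 -> 0 < k ->
  e = (1 - rho ^+ 2) / (k * rho ^+ 2) ->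
  [/\ 0 < e \/ e = 0 /\ rho = 0, rho ^+ 2 * e <= (1 - rho ^+ 2) / k &
      (1 - rho ^+ 2) * (1 + e^-1) = 1 + (k - 1) * rho ^+ 2].
Proof.
move=> rho0 rho1 k0 ->.
have p0 : 0 < 1 - rho ^+ 2 by rewrite subr_gt0 expr_lt1.
have [->|r0] := eqVneq rho 0.
  rewrite expr0n !mulr0 invr0 mulr0 invr0 subr0 !addr0 mulr1.
  by split => //; [right|rewrite mul0r divr_ge0// ltW].
have rho2 : 0 < rho ^+ 2 by rewrite exprn_gt0// lt_def r0.
split; first by left; rewrite divr_gt0// mulr_gt0.
  by rewrite le_eqVlt; apply/orP; left; apply/eqP; field; rewrite r0 gt_eqF.
have p0' : 1 - rho ^+ 2 != 0 by rewrite gt_eqF.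
by field; rewrite r0 p0' gt_eqF.
Qed.

Lemma sqr_unit (K : realType) (a : K) : 0 < a -> a <= 1 -> 0 <= a ^+ 2 <= a.
Proof. by move=> a0 a1; rewrite sqr_ge0 expr2 ler_piMr// ltW. Qed.

Lemma ler_unitr (K : realType) (a b : K) : 0 <= a -> b <= 1 -> a * b <= a.
Proof. by move=> a0 b1; rewrite ler_piMr. Qed.

(** The explicit bound on alpha is far smaller than what the decrease needs. These
    are weakened forms of it, relative to kappa, p = 1 - rhoR^2 and q = 1 - rhoC^2,
    in which small constants suffice. *)
Lemma explicit_rates (K : realType) (a LF N L p q r0 c0 k : K) :
  0 < a -> 0 <= LF -> 1 <= N -> 0 < L -> 0 < p <= 1 -> 0 < q <= 1 ->
  0 < r0 <= 1 -> 0 < c0 <= 1 -> k = c0 * r0 / (24 * L) * p * q ->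
  a <= p ^+ 2 * q ^+ 2 * r0 ^+ 2 * c0 ^+ 2 / (1152 * L * (LF + 16 * N)) ->
  [/\ 64 * a <= k * q * r0, 16 * (a * LF) <= k * q,
      64 * (a * L * N) <= p * r0 & 64 * (a * L) <= q ^+ 2 * c0].
Proof.
move=> a0 LF0 N1 L0 /andP[p0 p1] /andP[q0 q1] /andP[r00 r01] /andP[c00 c01] kE ha.
have N0 : 0 < N by exact: lt_le_trans N1.
have D0 : 0 < 24 * (48 * L * (LF + 16 * N)).
  by do 2![apply: mulr_gt0 => //]; [exact: mulr_gt0|rewrite ltr_wpDl// mulr_gt0].
have E1152 : 1152 * L * (LF + 16 * N) = 24 * (48 * L * (LF + 16 * N)).
  by rewrite !mulrA -natrM.
move: ha; rewrite E1152 ler_pdivlMr// => {D0 E1152} ha.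
have k0 : 0 < k by rewrite kE !mulr_gt0// invr_gt0 mulr_gt0.
have aN : a * 1 <= a * N by rewrite ler_wpM2l// ltW.
have aLN : a * L * 1 <= a * L * N by rewrite ler_wpM2l// mulr_ge0// ltW.
have aL0 : 0 <= a * L by rewrite mulr_ge0// ltW.
have aLF0 : 0 <= a * LF by rewrite mulr_ge0// ltW.
have aLLF0 : 0 <= a * L * LF by rewrite !mulr_ge0// ltW.
(* dividing the bound on a by k removes L, one factor p q r0 c0 and 24 *)
have H : 48 * (a * (LF + 16 * N)) <= k * q * (p * (r0 * c0)).
  rewrite -(ler_pM2l (mulr_gt0 (ltr0n K 24) L0)).
  apply: le_trans (_ : p ^+ 2 * q ^+ 2 * r0 ^+ 2 * c0 ^+ 2 <= _).
    by apply: le_trans ha; rewrite le_eqVlt; apply/orP; left; apply/eqP; clear; ring.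
  by rewrite kE le_eqVlt; apply/orP; left; apply/eqP; field; rewrite gt_eqF.
have p01 : 0 <= p by exact: ltW.
have q01 : 0 <= q by exact: ltW.
have r001 : 0 <= r0 by exact: ltW.
have c001 : 0 <= c0 by exact: ltW.
have kq0 : 0 <= k * q by rewrite mulr_ge0// ltW.
have rc : r0 * c0 <= 1 by apply: mulr_ile1.
have rc0 : 0 <= r0 * c0 by apply: mulr_ge0.
have B1 : k * q * (p * (r0 * c0)) <= k * q * r0.
  rewrite (_ : _ * _ = k * q * r0 * (p * c0)); last by ring.
  by apply: ler_unitr; [exact: mulr_ge0|exact: mulr_ile1].
have B2 : k * q * (p * (r0 * c0)) <= k * q.
  by apply: ler_unitr => //; exact: mulr_ile1.
have [/andP[pp0 pp] /andP[qq0 qq]] := conj (sqr_unit p0 p1) (sqr_unit q0 q1).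
have [/andP[rr0 rr] /andP[cc0 cc]] := conj (sqr_unit r00 r01) (sqr_unit c00 c01).
have B3 : p ^+ 2 * q ^+ 2 * r0 ^+ 2 * c0 ^+ 2 <= p * r0.
  rewrite (_ : _ * _ = p ^+ 2 * r0 ^+ 2 * (q ^+ 2 * c0 ^+ 2)); last by ring.
  apply: (@le_trans _ _ (p ^+ 2 * r0 ^+ 2)); last exact: ler_pM.
  apply: ler_unitr; first exact: mulr_ge0.
  by apply: mulr_ile1 => //; [exact: le_trans qq q1|exact: le_trans cc c01].
have B4 : p ^+ 2 * q ^+ 2 * r0 ^+ 2 * c0 ^+ 2 <= q ^+ 2 * c0.
  rewrite (_ : _ * _ = q ^+ 2 * c0 ^+ 2 * (p ^+ 2 * r0 ^+ 2)); last by ring.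
  apply: (@le_trans _ _ (q ^+ 2 * c0 ^+ 2)); last exact: ler_pM.
  apply: ler_unitr; first exact: mulr_ge0.
  by apply: mulr_ile1 => //; [exact: le_trans pp p1|exact: le_trans rr r01].
split.
- by apply: le_trans B1; apply: le_trans H; clear -a0 aN aLF0 aLLF0 aLN aL0; lra.
- by apply: le_trans B2; apply: le_trans H; clear -a0 aN aLF0 aLLF0 aLN aL0; lra.
- by apply: le_trans B3; apply: le_trans ha; clear -a0 aN aLF0 aLLF0 aLN aL0; lra.
- by apply: le_trans B4; apply: le_trans ha; clear -a0 aN aLF0 aLLF0 aLN aL0; lra.
Qed.

(** Of the contraction gap 2 (p - p / 4) the tracking error takes 2 kw <= p / 2, and
    the term in alpha a small fraction of p. *)
Lemma explicit_consensus (K : realType) (a N L r0 z p P Q ex kw : K) :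
  0 <= a * L * N -> 0 < r0 -> 0 < z <= 1 -> p = 1 - P -> 0 < p -> Q <= 1 ->
  64 * (a * L * N) <= p * r0 -> P * ex <= p / 4 -> kw = p * (1 + Q) / 8 ->
  a * N * L * r0^-1 / 2 * (1 + (1 + z)) + 2 * kw < 2 * (1 - P * (1 + ex)).
Proof.
move=> a0 r00 /andP[z0 z1] pE p0 Q1 h hex ->.
have h0 : a * L * N / r0 <= p / 64 by rewrite ler_pdivrMr//; clear -h; lra.
have h00 : 0 <= a * L * N / r0 by rewrite divr_ge0// ltW.
have h1 : a * L * N / r0 * (1 + (1 + z)) <= p / 64 * 3.
  by apply: ler_pM => //; [rewrite !addr_ge0// ltW|clear -z1; lra].
have pQ : p * Q <= p * 1 by rewrite ler_wpM2l// ltW.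
rewrite pE in h1 hex pQ p0 *; clear -h1 hex pQ p0; lra.
Qed.

(** Half of the contraction gap kappa q is left after the choice of epsy, and each
    term in alpha takes a small fraction of it. *)
Lemma explicit_tracking (K : realType) (a LF L r0 c0 rM cM z u w q Q ey k : K) :
  0 < a <= 4^-1 -> 0 <= LF -> 0 < L -> 0 < r0 <= 1 -> 0 < c0 -> 0 <= rM <= 1 ->
  0 <= cM <= 1 -> r0 <= z -> 0 < q <= 1 -> q = 1 - Q -> 0 <= w -> 0 < k ->
  q * w = 1 + Q -> Q * ey <= q / 2 -> 0 <= Q -> a * (2 * u) <= 2^-1 -> 0 <= u ->
  64 * a <= k * q * r0 -> 16 * (a * LF) <= k * q -> 64 * (a * L) <= q ^+ 2 * c0 ->
  a / 2 * cM * (1 + (1 + z^-1)) +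
    a ^+ 2 * (LF * cM + 2 * (2 * (rM * cM) * u) + 2 * k * (3 * c0^-1 * cM * L) * w)
  < k * (1 - Q * (1 + ey)).
Proof.
move=> /andP[a0 a4] LF0 L0 /andP[r00 r01] c00 /andP[rM0 rM1] /andP[cM0 cM1] rz
  /andP[q0 q1] qE w0 k0 qw hey Q0 au u0 h1 h2 h3.
have kq0 : 0 < k * q by rewrite mulr_gt0.
have t1 : a * (cM * (1 + (1 + z^-1))) <= 3 / 64 * (k * q).
  have z0 : 0 < z by exact: lt_le_trans rz.
  have iz : z^-1 <= r0^-1 by rewrite lef_pV2.
  have ir : 1 <= r0^-1 by rewrite invf_ge1.
  have iz0 : 0 <= z^-1 by rewrite invr_ge0 ltW.
  have s3 : cM * (1 + (1 + z^-1)) <= 1 * (3 * r0^-1).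
    by apply: ler_pM => //; [rewrite !addr_ge0|clear -iz ir; lra].
  have ar : a / r0 <= k * q / 64 by rewrite ler_pdivrMr//; clear -h1; lra.
  have := ler_wpM2l (ltW a0) s3; clear -ar; lra.
have t2 : a ^+ 2 * (LF * cM) <= k * q / 64.
  have aLF0 : 0 <= a * LF by rewrite mulr_ge0// ltW.
  have s1 : a * cM <= 4^-1 * 1 by apply: ler_pM => //; exact: ltW.
  have := ler_wpM2r aLF0 s1; clear -h2; lra.
have t3 : a ^+ 2 * (2 * (2 * (rM * cM) * u)) <= k * q / 64.
  have s1 : rM * cM * (a * (2 * u)) <= 1 * 2^-1.
    apply: ler_pM => //; [exact: mulr_ge0| |exact: mulr_ile1].
    by apply: mulr_ge0; [exact: ltW|exact: mulr_ge0].
  have s2 : k * q * r0 <= k * q by rewrite ler_piMr// ltW.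
  have := ler_wpM2l (ltW a0) s1; clear -s2 h1; lra.
have t4 : a ^+ 2 * (2 * k * (3 * c0^-1 * cM * L) * w) <= 3 * (k * q) / 64.
  have s1 : a * L / c0 <= q ^+ 2 / 64 by rewrite ler_pdivrMr//; clear -h3; lra.
  have s2 : a * L / c0 * w <= q / 64 * 2.
    apply: le_trans (ler_wpM2r w0 s1) _.
    rewrite (_ : _ * w = q / 64 * (q * w)); last by ring.
    rewrite ler_wpM2l ?divr_ge0 ?(ltW q0)// qw; clear -qE q0; lra.
  have s3 : a * cM * (a * L / c0 * w) <= 4^-1 * 1 * (q / 64 * 2).
    apply: ler_pM => //; [by rewrite mulr_ge0// ltW| |by apply: ler_pM => //; exact: ltW].
    by rewrite mulr_ge0// divr_ge0 ?mulr_ge0// ltW.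
  have := ler_wpM2l (ltW k0) s3; clear -kq0 ; lra.
have key : k * (Q * ey) <= k * (q / 2) by rewrite ler_wpM2l// ltW.
rewrite qE in kq0 key t1 t2 t3 t4; clear -kq0 key t1 t2 t3 t4; lra.
Qed.

Lemma explicit_descent (K : realType) (a LF z N u k5 kw : K) :
  0 < a -> 1 <= N -> 1 <= u -> 0 <= k5 -> kw <= 2^-1 ->
  a * (LF * z ^+ 2 + 2 * N * u + k5) < z / 2 ->
  a * (LF * z ^+ 2 + u + 2 * kw) < z / 2.
Proof.
move=> a0 N1 u1 k50 kw1; apply: le_lt_trans; rewrite ler_wpM2l ?(ltW a0)//.
have : 1 * u <= N * u by rewrite ler_wpM2r//; lra.
lra.
Qed.

(** Besides the explicit bound on alpha, the requirement 0 < Gammat enters: it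
    gives the condition on the coefficient of G, and alpha <= 1/4, which controls
    the terms in alpha^2 even when the Lipschitz constants are small. *)
Lemma explicit_admissible (K : realType) n (R C : 'M[K]_n) (r c : 'cV[K]_n)
    (Lc LF alpha ex ey e1 kappa : K) :
  stochastic_vec r -> stochastic_vec c -> 0 < vmin r -> 0 < vmin c -> 0 <= LF ->
  rhoR R r < 1 -> rhoC C c < 1 ->
  explicit_step R C r c Lc LF alpha ex ey e1 kappa ->
  admissible R C r c Lc LF alpha ex ey e1 kappa.
Proof.
move=> hr hc rm cm LF0 rhoR1 rhoC1 [[exE eyE] e1E kE /andP[a0 ha] hG].
have z0 : 0 < zeta r c by apply: lt_le_trans rm (vmin_le_zeta _ hc).
have z1 := zeta_le1 hr hc.
have n1 : 1 <= n%:R :> K by rewrite ler1n (stochastic_dim_gt0 hr).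
have P0 : 0 <= rhoR R r ^+ 2 by exact: sqr_ge0.
have Q0 : 0 <= rhoC C c ^+ 2 by exact: sqr_ge0.
have p0 : 0 < 1 - rhoR R r ^+ 2 by rewrite subr_gt0 expr_lt1// opnorm2_ge0.
have q0 : 0 < 1 - rhoC C c ^+ 2 by rewrite subr_gt0 expr_lt1// opnorm2_ge0.
have Lc2 : 0 < Lc ^+ 2.
  rewrite lt_def sqr_ge0 andbT; apply: contraTneq a0 => Lc0.
  by rewrite -leNgt; apply: le_trans ha _; rewrite Lc0 mulr0 mul0r invr0 mulr0.
have four0 : (0 : K) < 4 by []; have two0 : (0 : K) < 2 by [].
have [hex hPex _] := eps_choice (opnorm2_ge0 _) rhoR1 four0 exE.
have [hey hQey qw] := eps_choice (opnorm2_ge0 _) rhoC1 two0 eyE.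
rewrite -/(rhoR R r) in hex hPex; rewrite -/(rhoC C c) in hey hQey qw.
have u0 : 0 <= ex^-1 by rewrite invr_ge0; case: hex => [/ltW//|[->]].
have w0 : 0 <= ey^-1 by rewrite invr_ge0; case: hey => [/ltW//|[->]].
move: kE ha hG hPex hQey qw p0 q0 P0 Q0.
rewrite /admissible /Gammat /K4 /K5 /K2 K6E// K_2R_sq// K_2C_sq K_C2_sq// K_RC_sq.
have cM0 : 0 <= vmax c by exact: vmax_ge0.
have cM1 := vmax_le1 hc.
have rM0 : 0 <= vmax r by exact: vmax_ge0.
have rM1 := vmax_le1 hr.
have rm1 := vmin_le1 r.
have cm1 := vmin_le1 c.
have rmz : vmin r <= zeta r c by exact: vmin_le_zeta.
move: {exE eyE} hex hey.
move: (rhoR R r) (rhoC C c) {rhoR1 rhoC1} => P Q hex hey.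
rewrite /K3 e1E.
move: (zeta r c) (vmin r) (vmin c) (vmax r) (vmax c)
  z0 z1 rm cm cM0 cM1 rM0 rM1 rm1 cm1 rmz.
move: (n%:R : K) n1 => N n1 z r0 c0 rM cM z0 z1 r00 c00 cM0 cM1 rM0 rM1 rm1 cm1 rz.
set p := 1 - P ^+ 2; set q := 1 - Q ^+ 2; set w := 1 + ey^-1; set u := 1 + ex^-1.
move: (Lc ^+ 2) Lc2 => L L0.
move=> kE ha hG hPex hQey qw p0 q0 P0 Q0.
have {}qw : q * w = 1 + Q ^+ 2 by rewrite qw; clear; ring.
have u1 : 1 <= u by rewrite lerDl.
have w1 : 0 <= w by rewrite addr_ge0.
have Ppos : 0 <= P ^+ 2 by []; have Qpos : 0 <= Q ^+ 2 by [].
have p1 : p <= 1 by rewrite gerBl.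
have q1 : q <= 1 by rewrite gerBl.
have Q1 : Q ^+ 2 <= 1 by rewrite -subr_ge0 ltW.
have k0 : 0 < kappa by rewrite kE !mulr_gt0// invr_gt0 mulr_gt0.
have z10 : 0 < 1 + z by rewrite addr_gt0.
have e10 : 0 < z / (1 + z) by rewrite divr_gt0.
have ze1 : z / (z / (1 + z)) = 1 + z by rewrite invf_div mulrCA divff ?mulr1// gt_eqF.
have ie1 : (z / (1 + z))^-1 = 1 + z^-1.
  by rewrite invf_div mulrDl mul1r divff ?gt_eqF// addrC.
have ez : z - z / (1 + z) * z / 2 - z / (1 + z) / 2 = z / 2.
  by clear -z10; field; rewrite gt_eqF.
have kK6w : kappa * (3 * L / (c0 * r0)) * w = p * (1 + Q ^+ 2) / 8.
  by rewrite -qw kE; clear -r00 c00 L0; field; rewrite !gt_eqF.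
have [h1 h2 h3 h4] := @explicit_rates _ alpha LF N L p q r0 c0 kappa a0 LF0 n1 L0
  (introT andP (conj p0 p1)) (introT andP (conj q0 q1))
  (introT andP (conj r00 rm1)) (introT andP (conj c00 cm1)) kE ha.
rewrite {}ez in hG *; rewrite {}ze1 {}ie1.
have gam : alpha * (LF * z ^+ 2 + 2 * N * u + 3 * c0^-1 * L * kappa) < z / 2.
  by rewrite -(ltr_pM2l a0); clear -hG; lra.
have K5k0 : 0 <= 3 * c0^-1 * L * kappa by rewrite !mulr_ge0 ?invr_ge0// ltW.
have kw2 : kappa * (3 * c0^-1 * L) * w <= 2^-1.
  have -> : kappa * (3 * c0^-1 * L) * w = r0 * (kappa * (3 * L / (c0 * r0)) * w).
    by clear -r00 c00; field; rewrite !gt_eqF.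
  rewrite kK6w; apply: (@le_trans _ _ (1 * (1 * 2 / 8))); last by clear; lra.
  apply: ler_pM; rewrite ?(ltW r00)//.
    by rewrite divr_ge0// mulr_ge0 ?(ltW p0) ?addr_ge0.
  rewrite ler_pM2r ?invr_gt0//; apply: ler_pM; rewrite ?(ltW p0) ?addr_ge0//.
  clear -Q1; lra.
have gam2 := explicit_descent a0 n1 u1 K5k0 kw2 gam.
have au : alpha * (2 * u) <= 2^-1.
  have LFz0 : 0 <= LF * z ^+ 2 by rewrite mulr_ge0 ?sqr_ge0.
  have Nu : 1 * u <= N * u by rewrite ler_wpM2r ?(le_trans ler01).
  have : alpha * (2 * u) <= alpha * (LF * z ^+ 2 + 2 * N * u + 3 * c0^-1 * L * kappa).
    by rewrite ler_wpM2l ?(ltW a0)//; clear -LFz0 Nu K5k0; lra.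
  by clear -gam z1; lra.
have a4 : 0 < alpha <= 4^-1.
  have : alpha * (2 * 1) <= alpha * (2 * u) by rewrite ler_wpM2l ?(ltW a0)// ler_wpM2l.
  by rewrite a0; clear -au; lra.
split => //.
- apply: explicit_consensus Q1 h3 hPex kK6w => //.
    by rewrite !mulr_ge0 ?(ltW a0) ?(ltW L0)// (le_trans ler01).
  by rewrite z0.
- apply: (explicit_tracking a4 LF0 L0 _ c00 _ _ rz _ _ w1 k0 qw hQey Qpos au _
    h1 h2 h4) => //;
    by rewrite ?r00 ?rM0 ?cM0 ?q0 ?(le_trans ler01 u1).
- rewrite -/w -/u (_ : _ * _ * w = 2 * (kappa * (3 * c0^-1 * L) * w))//.
  by clear; ring.
Qed.

(** * Summability, limits and hitting times *)

Lemma cvg0_bounded_sums (K : realType) (S : nat -> K) (B : K) :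
  (forall nu, 0 <= S nu) -> (forall N, \sum_(0 <= nu < N) S nu <= B) ->
  cvgn (series S).
Proof.
move=> S0 SB; apply: nondecreasing_is_cvgn.
  by apply/nondecreasing_seqP => k; rewrite seriesSr lerDl.
by exists B => _ [N _ <-]; exact: SB.
Qed.

Lemma descent_sum (K : realType) (V S : nat -> K) (delta lb : K) :
  0 < delta -> (forall nu, lb <= V nu) ->
  (forall nu, V nu.+1 <= V nu - delta * S nu) ->
  forall N, \sum_(0 <= nu < N) S nu <= (V 0%N - lb) / delta.
Proof.
move=> d0 Vlb VS N; rewrite ler_pdivlMr// mulrC mulr_sumr.
suff : \sum_(0 <= nu < N) delta * S nu <= V 0%N - V N by have := Vlb N; lra.
elim: N => [|N IH]; first by rewrite big_geq// subrr.
by rewrite big_nat_recr//=; have := VS N; lra.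
Qed.

(** While d stays above eps, each step costs eps^2 of a convergent series. Only the
    tail of the series pays for the late steps, whence o(1 / eps^2) and not just
    O(1 / eps^2). *)
Lemma first_hit_rate (K : realType) (d : nat -> K) (B : K) :
  (forall nu, 0 <= d nu) -> (forall N, \sum_(0 <= nu < N) d nu ^+ 2 <= B) ->
  exists T : K -> nat,
    (forall eps : K, 0 < eps -> is_first (fun nu => d nu <= eps) (T eps)) /\
    (fun eps : K => (T eps)%:R : K) =o_ (at_right (0 : K)) (fun eps : K => (eps ^+ 2)^-1).
Proof.
move=> d0 dB.
have cs := cvg0_bounded_sums (fun nu => sqr_ge0 (d nu)) dB.
have hit eps : 0 < eps -> exists nu, d nu <= eps.
  move=> e0; apply: contrapT => /forallNP nohit.
  have := cvg_series_cvg_0 cs => /cvgr0Pnorm_lt/(_ _ (exprn_gt0 2 e0)).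
  move=> [N _ /(_ N (leqnn _))] /=.
  rewrite ger0_norm ?sqr_ge0// ltr_pXn2r// ?nnegrE// ?(ltW e0)//.
  by move=> /ltW; exact: nohit.
pose T eps := if pselect (exists nu, d nu <= eps) is left h then ex_minn h else 0%N.
have TP eps : 0 < eps -> is_first (fun nu => d nu <= eps) (T eps).
  move=> /hit h; rewrite /T; case: pselect => // h'.
  by case: ex_minnP => t dt tmin; split.
exists T; split => //; apply/eqoP => eta eta0.
have [N _ tail] : \forall N \near \oo,
    `|limn (series (fun nu => d nu ^+ 2)) - series (fun nu => d nu ^+ 2) N| <= eta / 2.
  by move: cs => /cvgrPdist_le; apply; rewrite divr_gt0.
have {}tail M : (N <= M)%N -> \sum_(N <= nu < M) d nu ^+ 2 <= eta / 2.
  move=> NM; have := tail N (leqnn N); rewrite /= ler_norml => /andP[_].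
  have ndec : nondecreasing_seq (series (fun nu => d nu ^+ 2)).
    by apply/nondecreasing_seqP => k; rewrite seriesSr lerDl sqr_ge0.
  move=> limN; have limM := nondecreasing_cvgn_le ndec cs M.
  have sM : series (fun nu => d nu ^+ 2) M = series (fun nu => d nu ^+ 2) N +
      \sum_(N <= nu < M) d nu ^+ 2 by rewrite /series /= [LHS](big_cat_nat (leq0n N) NM).
  lra.
(* the N early steps are paid for by a small eps, the later ones by the tail *)
near=> eps.
have e0 : 0 < eps by [].
have e2 : 0 < eps ^+ 2 by rewrite exprn_gt0.
rewrite ger0_norm// ger0_norm ?invr_ge0 ?sqr_ge0// ler_pdivlMr//.
have Neps : N%:R * eps ^+ 2 <= eta / 2.
  have eps1 : eps <= 1 by near: eps; exact: nbhs_right_le.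
  have epsN : eps <= eta / 2 / N.+1%:R.
    by near: eps; apply: nbhs_right_le; rewrite !divr_gt0.
  have : eps * N.+1%:R <= eta / 2 by rewrite -ler_pdivlMr.
  apply: le_trans; rewrite mulrC expr2 -mulrA ler_wpM2l ?(ltW e0)//.
  apply: (@le_trans _ _ (1 * N%:R)); first by rewrite ler_wpM2r.
  by rewrite mul1r ler_nat.
have [TN|NT] := leqP (T eps) N.
  apply: le_trans (_ : N%:R * eps ^+ 2 <= _); first by rewrite ler_wpM2r ?sqr_ge0// ler_nat.
  lra.
have : \sum_(N <= nu < T eps) eps ^+ 2 <= \sum_(N <= nu < T eps) d nu ^+ 2.
  apply: ler_sum_nat => nu /andP[_ nuT].
  rewrite ler_pXn2r ?nnegrE ?(ltW e0)// ltW// ltNge; apply/negP => dnu.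
  by have := (TP _ e0).2 _ dnu; rewrite leqNgt nuT.
rewrite sumr_const_nat -(mulr_natl (eps ^+ 2)) natrB ?(ltnW NT)// mulrBl.
have := tail _ (ltnW NT); lra.
Unshelve. all: end_near. Qed.

Lemma sq_thin (K : realType) p (w : 'I_p -> K) (A : 'M[K]_(p, 0)) : wsq w A = 0.
Proof. by rewrite /wsq big1// => i _; rewrite big_ord0 mulr0. Qed.

Lemma lipschitz_const_ge0 (K : realType) m (LF : K) (g : 'rV[K]_m -> 'rV[K]_m) :
  (0 < m)%N -> elipschitz LF g -> 0 <= LF.
Proof.
case: m g => // m g _ /(_ (const_mx 1) 0) h.
have {h} : 0 <= LF * enorm (const_mx 1 - 0 : 'rV[K]_m.+1) by exact: le_trans (enorm_ge0 _) h.
rewrite subr0 pmulr_lge0// lt_def enorm_ge0 andbT.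
apply/eqP => h; have := sq_entry (const_mx 1 : 'rV[K]_m.+1) 0 0.
by rewrite -enorm_sq h mxE expr1n expr0n ler10.
Qed.

Lemma cvg_sqrt0 (K : realType) (u : nat -> K) :
  u nu @[nu --> \oo] --> (0 : K) -> Num.sqrt (u nu) @[nu --> \oo] --> (0 : K).
Proof.
move=> u0; apply: (cvg_comp _ _ u0).
by have := @sqrt_continuous K 0; rewrite /continuous_at sqrtr0.
Qed.

Lemma continuous_row (K : realType) n m (i : 'I_n) :
  continuous (fun A : 'M[K]_(n, m) => row i A).
Proof.
move=> A S [P nP PS].
exists (fun k j => [set t | k = i -> P 0 j t]) => [k j|B hB]; last first.
  by apply: PS => k j; rewrite ord1 mxE; exact: hB.
have [->|ki] := eqVneq k i.
  by have := nP 0 j; rewrite mxE; apply: filterS => t /= Pt _.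
by apply: filterS filterT => t _ /eqP; rewrite (negbTE ki).
Qed.

(** As s >= 1, each partial derivative of f_i is itself differentiable. *)
Lemma continuous_grad_row (K : realType) n m s (f : 'I_n -> 'rV[K]_m -> K) i j :
  (1 <= s)%N -> (forall i, class_C s.+1 (f i)) ->
  continuous (fun x : 'M[K]_(n, m) => grad (f i) (row i x) 0 j).
Proof.
case: s => // s _ /(_ i)[_ /(_ (delta_mx 0 j)) [dD _]] x.
under eq_fun do rewrite mxE.
apply: (@continuous_comp _ _ _ (row i) ('D_(delta_mx 0 j) (f i)));
  first exact: continuous_row.
exact: differentiable_continuous.
Qed.

(** Near a cluster point l the function is close to h l, and there are arbitrarily
    late terms near l. *)
Lemma cluster_cvg0 (K : realType) (T : topologicalType) (x : nat -> T) (h : T -> K) (l : T) :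
  {for l, continuous h} -> h (x nu) @[nu --> \oo] --> (0 : K) ->
  cluster (x @ \oo) l -> h l = 0.
Proof.
move=> ch h0 cl; apply/eqP; apply: contraT => hl.
have hl2 : 0 < `|h l| / 2 by rewrite divr_gt0 ?normr_gt0.
have A1 : (x @ \oo) [set t | `|h t| < `|h l| / 2].
  by move/cvgr0Pnorm_lt : h0 => /(_ _ hl2).
have A2 : nbhs l [set t | `|h l - h t| < `|h l| / 2].
  by move/cvgrPdist_lt : ch => /(_ _ hl2).
have [t [/= t1 t2]] := cl _ _ A1 A2.
have := ler_normD (h l - h t) (h t); rewrite subrK; lra.
Qed.

(** The absolute values of the three coefficients under the root give a bound, as a
    negative radicand has root 0. *)
Lemma dfun_le (K : realType) n m (f : 'I_n -> 'rV[K]_m -> K) (R C : 'M[K]_n)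
    (r c : 'cV[K]_n) (Lc LF alpha ex ey e1 kappa : K) :
  (forall i, 0 < r i 0) -> (forall i, 0 < c i 0) ->
  exists2 M, 0 <= M & forall x y,
    (ones K n)^T *m y = \sum_i grad (f i) (row i x) ->
    dfun f R C r c Lc LF alpha ex ey e1 kappa x y ^+ 2 <=
    M * (cons_err r x + track_err c y + mean_sq y).
Proof.
move=> r0 c0.
pose a := 1 - rhotR R r c Lc alpha ex ey e1 kappa.
pose b := kappa * (1 - rhotC C r c Lc LF alpha ex ey e1 kappa).
pose g := Gammat r c Lc LF alpha ex e1 kappa.
exists (`|a| + `|b| + `|g|); first by rewrite !addr_ge0.
move=> x y yE.
have X0 : 0 <= cons_err r x by apply: wsq_ge0 => i; exact: ltW.
have Y0 : 0 <= track_err c y by apply: wsq_ge0 => i; rewrite invr_ge0 ltW.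
have G0 : 0 <= mean_sq y by exact: sq_ge0.
rewrite /dfun normR_sq// normC_sq// enorm_sq -yE -/a -/b -/g.
rewrite -/(cons_err r x) -/(track_err c y) -/(mean_sq y).
set t := a * _ + _ + _.
have tle : t <= (`|a| + `|b| + `|g|) * (cons_err r x + track_err c y + mean_sq y).
  have h1 := ler_wpM2r X0 (ler_norm a).
  have h2 := ler_wpM2r Y0 (ler_norm b).
  have h3 := ler_wpM2r G0 (ler_norm g).
  have aY := mulr_ge0 (normr_ge0 a) Y0; have aG := mulr_ge0 (normr_ge0 a) G0.
  have bX := mulr_ge0 (normr_ge0 b) X0; have bG := mulr_ge0 (normr_ge0 b) G0.
  have gX := mulr_ge0 (normr_ge0 g) X0; have gY := mulr_ge0 (normr_ge0 g) Y0.
  rewrite /t; lra.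
have [t0|t0] := leP 0 t; first by rewrite sqr_sqrtr.
by rewrite ler0_sqrtr ?(ltW t0)// expr0n mulr_ge0 ?addr_ge0.
Qed.

(** The decrease of V is telescoped, with the lower bound of F. *)
Lemma summable_residuals (K : realType) (n m s : nat)
  (f : 'I_n -> 'rV[K]_m -> K) (L : 'I_n -> K) (LF : K)
  (R C : 'M[K]_n) (r c : 'cV[K]_n)
  (alpha epsx epsy eps1 kappa : K) (x y : nat -> 'M[K]_(n, m)) :
  (forall i, class_C s.+1 (f i)) -> (forall i, elipschitz (L i) (grad (f i))) ->
  elipschitz LF (grad (Fsum f)) -> coercive (Fsum f) ->
  row_stochastic R -> (forall i, 0 < R i i) -> connected_digraph (digraph_of R) ->
  col_stochastic C -> (forall i, 0 < C i i) -> connected_digraph (digraph_of C^T) ->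
  stochastic_vec r -> r^T *m R = r^T -> stochastic_vec c -> C *m c = c ->
  0 < vmin r -> 0 < vmin c ->
  explicit_step R C r c (Lmax L) LF alpha epsx epsy eps1 kappa \/
  base_step R C r c (Lmax L) LF alpha epsx epsy eps1 kappa ->
  dogt f R C alpha x y ->
  exists B, forall N, \sum_(0 <= nu < N)
    (cons_err r (x nu) + track_err c (y nu) + mean_sq (y nu)) <= B.
Proof.
move=> hC hL hLF hcoer Rs Rd Rc Cs Cd Cc hr hrR hc hCc hrmin hcmin hstep hxy.
(* for m = 0 the constant LF may be negative, but then all norms are 0 *)
have [m0|m0] := posnP m.
  move: x y {hxy hC hL hLF hcoer} f; rewrite m0 => x y _.
  exists 0 => N; rewrite big1// => nu _.
  by rewrite /cons_err /track_err /mean_sq !sq_thin !addr0.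
have LF0 := lipschitz_const_ge0 m0 hLF.
have r0 i : 0 < r i 0 by apply: lt_le_trans hrmin (vmin_le _ _).
have c0 i : 0 < c i 0 by apply: lt_le_trans hcmin (vmin_le _ _).
have rR1 := rhoR_lt1 Rs Rd Rc hrR hr.2 r0.
have rC1 := rhoC_lt1 Cs Cd Cc hCc hc.2 c0.
have adm : admissible R C r c (Lmax L) LF alpha epsx epsy eps1 kappa.
  by case: hstep => h; [exact: explicit_admissible|exact: base_admissible].
have df k z : differentiable (f k) z by exact: class_C_diff.
have cF : continuous (Fsum f).
  apply: continuous_sum => i z; exact: differentiable_continuous.
have [lb hlb] := coercive_bounded_below cF hcoer.
have [delta d0 step] := lyapunov_step df hL hLF LF0 Rs Cs hrR hCc hr hc hrmin hcmin
  (ltW rR1) adm hxy.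
have [[_ k0 _] _ _ _ _] := adm.
pose V nu := Fsum f (r^T *m x nu) + 2 * cons_err r (x nu) + kappa * track_err c (y nu).
exists ((V 0%N - lb) / delta); apply: descent_sum => // nu.
apply: le_trans (hlb (r^T *m x nu)) _; rewrite /V -addrA lerDl.
rewrite addr_ge0// mulr_ge0 ?(ltW k0)//; apply: wsq_ge0 => i; first exact: ltW.
by rewrite invr_ge0 ltW.
Qed.

(** * Convergence and rate *)

Theorem theorem4p5 (K : realType) (n m s : nat)
  (f : 'I_n -> 'rV[K]_m -> K) (L : 'I_n -> K) (LF : K)
  (hs : (1 <= s)%N)
  (hC : forall i, class_C s.+1 (f i))
  (hL : forall i, elipschitz (L i) (grad (f i)))
  (hLF : elipschitz LF (grad (Fsum f)))
  (hcoer : coercive (Fsum f))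
  (E : rel 'I_n) (hE : strongly_connected E)
  (R C : 'M[K]_n) (hW : weight_assumption E R C)
  (r c : 'cV[K]_n)
  (hr : stochastic_vec r) (hrR : r^T *m R = r^T)
  (hc : stochastic_vec c) (hCc : C *m c = c)
  (hrmin : 0 < vmin r) (hcmin : 0 < vmin c)
  (alpha epsx epsy eps1 kappa : K)
  (hstep : explicit_step R C r c (Lmax L) LF alpha epsx epsy eps1 kappa \/
           base_step R C r c (Lmax L) LF alpha epsx epsy eps1 kappa)
  (x y : nat -> 'M[K]_(n, m)) (hxy : dogt f R C alpha x y) :
  let xbar := fun nu => r^T *m x nu in
  let ybar := fun nu => (ones K n)^T *m y nu in
  let d := dfun f R C r c (Lmax L) LF alpha epsx epsy eps1 kappa in
  [/\ (enorm (x nu - ones K n *m xbar nu) @[nu --> \oo] --> (0 : K)) /\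
      (ybar nu @[nu --> \oo] --> (0 : 'rV[K]_m)),
      forall xinf : 'M[K]_(n, m), cluster (x @ \oo) xinf ->
        exists2 theta : 'rV[K]_m, crit (Fsum f) theta &
                                  xinf = ones K n *m theta
    & exists T : K -> nat,
        (forall eps : K, 0 < eps ->
           is_first (fun nu => d (x nu) (y nu) <= eps) (T eps)) /\
        (fun eps : K => (T eps)%:R : K) =o_ (at_right (0 : K)) (fun eps : K => (eps ^+ 2)^-1)].
Proof.
move=> xbar ybar d.
have [[Rs Rd] [Cs Cd] _ [treeR treeC] _] := hW.
have r0 i : 0 < r i 0 by apply: lt_le_trans hrmin (vmin_le _ _).
have c0 i : 0 < c i 0 by apply: lt_le_trans hcmin (vmin_le _ _).
have df k z : differentiable (f k) z by exact: (class_C_diff (hC k)).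
have yE nu : (ones K n)^T *m y nu = \sum_i grad (f i) (row i (x nu)).
  by rewrite (ybar_tracking Cs hxy) ones_gradFc.
have [B SB] := summable_residuals hC hL hLF hcoer Rs Rd (tree_connected treeR)
  Cs Cd (tree_connected treeC) hr hrR hc hCc hrmin hcmin hstep hxy.
pose S nu := cons_err r (x nu) + track_err c (y nu) + mean_sq (y nu).
rewrite -/S in SB.
have X0 nu : 0 <= cons_err r (x nu) by apply: wsq_ge0 => i; exact: ltW.
have Y0 nu : 0 <= track_err c (y nu).
  by apply: wsq_ge0 => i; rewrite invr_ge0 ltW.
have G0 nu : 0 <= mean_sq (y nu) by exact: sq_ge0.
have S0 nu : 0 <= S nu by rewrite !addr_ge0.
have cvgS : S nu @[nu --> \oo] --> (0 : K).
  exact: cvg_series_cvg_0 (cvg0_bounded_sums S0 SB).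
have cvgX : cons_err r (x nu) @[nu --> \oo] --> (0 : K).
  apply: (squeeze_cvgr _ (cvg_cst (0 : K)) cvgS); apply: nearW => nu.
  by rewrite X0 /S -addrA lerDl addr_ge0.
have cvgG : mean_sq (y nu) @[nu --> \oo] --> (0 : K).
  apply: (squeeze_cvgr _ (cvg_cst (0 : K)) cvgS); apply: nearW => nu.
  by rewrite G0 /S lerDr addr_ge0.
have cvgsq : sq ((1%:M - JR r) *m x nu) @[nu --> \oo] --> (0 : K).
  have h : (vmin r)^-1 * cons_err r (x nu) @[nu --> \oo] --> (0 : K).
    by rewrite -(mulr0 (vmin r)^-1); apply: cvgM => //; exact: cvg_cst.
  apply: (squeeze_cvgr _ (cvg_cst (0 : K)) h); apply: nearW => nu.
  by rewrite sq_ge0; exact: sq_le_vmin.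
split.
- split.
  + under eq_fun do rewrite -subJR_decomp enorm_sqrt; exact: cvg_sqrt0.
  + apply/norm_cvg0P.
    apply: (squeeze_cvgr _ (cvg_cst (0 : K)) (cvg_sqrt0 cvgG)); apply: nearW => nu.
    by rewrite normr_ge0 -enorm_sqrt; exact: norm_le_enorm.
- move=> xinf clx.
  have grad_cont i j : continuous (fun z : 'M[K]_(n, m) => grad (f i) (row i z) 0 j).
    exact: continuous_grad_row hs hC.
  have Xinf : sq ((1%:M - JR r) *m xinf) = 0.
    apply: (@cluster_cvg0 _ _ x (fun z => sq ((1%:M - JR r) *m z)) _ _ cvgsq clx).
    apply: continuous_sq_comp; apply: continuous_mulmx_entry => i j.
    exact: coord_continuous.
  have Ginf : sq (\sum_i grad (f i) (row i xinf)) = 0.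
    apply: (@cluster_cvg0 _ _ x (fun z => sq (\sum_i grad (f i) (row i z))) _ _ _ clx).
      apply: continuous_sq_comp => i j; under eq_fun do rewrite summxE.
      by rewrite ord1; apply: continuous_sum => k; exact: grad_cont.
    by under eq_fun do rewrite -yE.
  have xinfE : xinf = ones K n *m (r^T *m xinf).
    apply/eqP; rewrite -subr_eq0 -subJR_decomp; apply/eqP.
    by apply: (wsq_eq0 (fun=> ltr01)); rewrite Xinf.
  exists (r^T *m xinf) => //.
  rewrite /crit /= grad_Fsum//.
  have <- : \sum_i grad (f i) (row i xinf) = \sum_i grad (f i) (r^T *m xinf).
    apply: eq_bigr => i _; congr (grad _ _); apply/rowP => j.
    by rewrite {1}xinfE [LHS]mxE ones_mulE.
  by apply: (wsq_eq0 (fun=> ltr01)); rewrite Ginf.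
- have [M M0 dM] := dfun_le f R C (Lmax L) LF alpha epsx epsy eps1 kappa r0 c0.
  apply: (@first_hit_rate _ (fun nu => d (x nu) (y nu)) (M * B)) => [nu|N].
    exact: sqrtr_ge0.
  apply: le_trans (ler_wpM2l M0 (SB N)); rewrite mulr_sumr; apply: ler_sum => nu _.
  exact: dM.
Qed.
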